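(* There exist an absolute constant $C_1>0$ and, for each $D\ge1$, constants $C_2=C_2(D)$ and $\delta_*=\delta_*(D)>0$, and for each $(D,K,\sigma_{\max})$ a constant $C_3=C_3(D,K,\sigma_{\max})$, such that the following holds. Let $n\ge1$, $d,D\ge1$, $\mathcal Z\subset\mathbb R^d$ open, $P_Z$ a probability distribution on $\mathcal Z$, $K>0$, $0<\sigma_{\min}<\sigma_{\max}$ with $\sigma_{\min}\le 1$. Let $\mathcal F$ be a class of functions $\mathcal Z\to\mathbb R^D$ with $\| |{\bf f}|_\infty\|_\infty\le K$ for all ${\bf f}\in\mathcal F$, and suppose that for some $s\ge1$ and $A\ge1$, $$\log N(\delta,\mathcal F,\| |\cdot|_\infty\|_\infty)\le s\{A+1\vee\log\delta^{-1}\}\quad\text{for every }\delta>0.$$ Let ${\bf f}_*:\mathcal Z\to\mathbb R^D$ and $\sigma_*\in[\sigma_{\min},\sigma_{\max}]$, and suppose there exists ${\bf f}\in\mathcal F$ with $\| |{\bf f}-{\bf f}_*|_\infty\|_\infty\le\delta_{\rm app}$, where $\delta_{\rm app}\le1$. Let ${\bf X}_1,\dots,{\bf X}_n$ be i.i.d. from $P_*=P_{{\bf f}_*,\sigma_*}$ with density $p_*=p_{{\bf f}_*,\sigma_*}$, and let $\hat p=p_{\hat{\bf f},\hat\sigma}$ where $(\hat{\bf f},\hat\sigma)\in\mathcal F\times[\sigma_{\min},\sigma_{\max}]$ satisfies $$\sum_{i=1}^n\log p_{\hat{\bf f},\hat\sigma}({\bf X}_i)\ge\sup_{{\bf f}\in\mathcal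 F,\ \sigma\in[\sigma_{\min},\sigma_{\max}]}\sum_{i=1}^n\log p_{{\bf f},\sigma}({\bf X}_i)-\eta_n.$$ Define $$\epsilon_n^*=C_3\left(\sqrt{\frac{s\{A+\log(n/\sigma_{\min})\}}{n}}\ \vee\ \frac{\delta_{\rm app}}{\sigma_*}\right).$$ If $\eta_n\le\epsilon_n^{*2}/6$ and $\epsilon_n^*\le\sqrt2\,\delta_*$, then $$P_*\big(d_H(\hat p,p_* )>\epsilon_n^*\big)\le 5e^{-C_1n\epsilon_n^{*2}}+\frac{C_2}{n}.$$
   Context: For $\sigma>0$, $\phi_\sigma$ is the density of $\mathcal N({\bf 0}_D,\sigma^2\mathbb I_D)$. For ${\bf f}:\mathcal Z\to\mathbb R^D$, $P_{{\bf f},\sigma}$ is the distribution of ${\bf f}({\bf Z})+\boldsymbol\epsilon$ with ${\bf Z}\sim P_Z$ and $\boldsymbol\epsilon\sim\mathcal N({\bf 0}_D,\sigma^2\mathbb I_D)$ independent, with density $p_{{\bf f},\sigma}({\bf x})=\int\phi_\sigma({\bf x}-{\bf f}({\bf z}))dP_Z({\bf z})$. $\| |{\bf f}|_\infty\|_\infty=\sup_{\bf z}\max_j|f_j({\bf z})|$; $N(\delta,\mathcal F,d)$ is the $\delta$-covering number. $d_H$ is the Hellinger distance. $a\vee b=\max(a,b)$. *)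

(* Defs.v *)
From HB Require Import structures.
From mathcomp Require Import all_boot all_order all_algebra.
From mathcomp Require Export all_classical all_reals all_analysis.
Set Implicit Arguments. Unset Strict Implicit. Unset Printing Implicit Defensive.
Import Order.TTheory GRing.Theory Num.Theory.
Local Open Scope ring_scope.
Local Open Scope classical_set_scope.

Section Defs.
Context {R : realType}.

(* Points of R^k are k-tuples of reals (with the product/Borel sigma-algebra
   of measurable_tuple). *)

Definition tsub (k : nat) (x y : k.-tuple R) : k.-tuple R :=
  [tuple tnth x j - tnth y j | j < k].

Definition sqnorm (k : nat) (x : k.-tuple R) : R := \sum_(j < k) tnth x j ^+ 2.

Definition open_tuple_set (d : nat) (Z : set (d.-tuple R)) : Prop :=
  forall z, Z z -> exists r : R, 0 < r /\
    forall w : d.-tuple R, (forall j, `|tnth w j - tnth z j| < r) -> Z w.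

(* Lebesgue integral over R^k of a function with values in \bar R,
   as the iterated integral of the one-dimensional Lebesgue integrals
   (equal to the integral w.r.t. k-dim Lebesgue measure for nonnegative
   measurable integrands, by Tonelli). *)
Fixpoint lebint (k : nat) : (k.-tuple R -> \bar R) -> \bar R :=
  match k return (k.-tuple R -> \bar R) -> \bar R with
  | 0 => fun g => g [tuple]
  | m.+1 => fun g =>
      (\int[@lebesgue_measure R]_x lebint (fun t : m.-tuple R => g (cons_tuple x t)))%E
  end.

Definition phi (D : nat) (sigma : R) (x : D.-tuple R) : R :=
  ((Num.sqrt (2 * pi * sigma ^+ 2))^-1) ^+ D * expR (- sqnorm x / (2 * sigma ^+ 2)).

Definition pdens (d D : nat) (Z : set (d.-tuple R)) (PZ : probability (d.-tuple R) R)
  (f : d.-tuple R -> D.-tuple R) (sigma : R) (x : D.-tuple R) : R :=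
  fine (\int[PZ]_(z in Z) (phi sigma (tsub x (f z)))%:E)%E.

Definition supdist (d D : nat) (Z : set (d.-tuple R))
  (f g : d.-tuple R -> D.-tuple R) : \bar R :=
  ereal_sup [set (`|tnth (f z) j - tnth (g z) j|)%:E | z in Z & j in [set: 'I_D]].

(* a delta-cover of F by m balls (centers need not lie in F) *)
Definition is_cover (d D : nat) (Z : set (d.-tuple R))
  (F : set (d.-tuple R -> D.-tuple R)) (delta : R) (m : nat)
  (c : 'I_m -> d.-tuple R -> D.-tuple R) : Prop :=
  forall f, F f -> exists i : 'I_m, (supdist Z f (c i) <= delta%:E)%E.

(* covering number N(delta, F, || |.|_oo ||_oo), +oo if no finite cover *)
Definition covering_number (d D : nat) (Z : set (d.-tuple R))
  (F : set (d.-tuple R -> D.-tuple R)) (delta : R) : \bar R :=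
  ereal_inf [set (m%:R)%:E | m in [set m : nat | exists c, @is_cover d D Z F delta m c]].

Definition hellinger (D : nat) (p q : D.-tuple R -> R) : R :=
  Num.sqrt (fine (lebint (fun x => ((Num.sqrt (p x) - Num.sqrt (q x)) ^+ 2)%:E))).

End Defs.

(* Main.v *)
Require Import Defs.
From HB Require Import structures.
From mathcomp Require Import all_boot all_order all_algebra.
From mathcomp Require Import all_classical all_reals all_analysis.
From mathcomp Require Import measurable_realfun ring lra.
Set Implicit Arguments. Unset Strict Implicit. Unset Printing Implicit Defensive.
Import Order.TTheory GRing.Theory Num.Theory.
Import numFieldNormedType.Exports.
Local Open Scope ring_scope.
Local Open Scope classical_set_scope.

(** With [rho = 1/n], a Gaussian mixture [p_{f,s}] is dominated pointwise by
    [exp(3 rho D) p_{c,s'}] whenever [|f - c| <= rho s] and [s'/s] lies in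
    [[1 + rho, (1 + rho)^2]]. A sup-norm cover of [F] and an arithmetic grid of scales thus
    give finitely many multiples of mixture densities that dominate the whole model, with
    log-cardinality of order [s (A + log (n / sigma_min))]. If [p <= e^m q] and [p] is at
    Hellinger distance more than [eps] from [p_star], the affinity of [q] and [p_star] is at
    most [exp(m/2 - eps^2/4)], so by Markov's inequality for the product of [sqrt(q/p_star)]
    and a union bound no such [p] has a large likelihood. On the other hand, by convexity of
    [p^2/q] the likelihood ratio [p_star/p_{f,sigma_star}] of a good approximant [f] has mean
    at most [exp(D (delta_app/sigma_star)^2)], and Markov's inequality bounds the likelihood of
    that approximant from below. One covering scale suffices, and [C2 = 0], [delta_star = 1]
    work. *)

Section weighted_image.
Import HBNNSimple.
Local Open Scope ereal_scope.
Context {R : realType} d d' (T : measurableType d) (S : measurableType d').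
Context (mu : {measure set T -> \bar R}) (nu : {measure set S -> \bar R}).
Context (X : T -> S) (W : T -> R).
Hypotheses (mX : measurable_fun setT X) (mW : measurable_fun setT W).
Hypothesis W_ge0 : forall x, (0 <= W x)%R.
Hypothesis nuE : forall B, measurable B ->
  nu B = \int[mu]_(x in X @^-1` B) (W x)%:E.

Lemma integral_weighted_image_nnsfun (h : {nnsfun S >-> R}) :
  \int[nu]_y (h y)%:E = \int[mu]_x (W x * h (X x))%:E.
Proof.
have mlevel y : measurable (X @^-1` (h @^-1` [set y])).
  by rewrite -[X in measurable X]setTI; exact: mX.
transitivity (\int[mu]_x (\sum_(y \in range h)
    (y * (W x * \1_(X @^-1` (h @^-1` [set y])) x))%:E)%R); last first.
  apply: eq_integral => x _; rewrite fsumEFin//; congr EFin.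
  rewrite [in RHS]fimfunE mulr_fsumr//.
  by apply: eq_fsbigr => y _; rewrite mulrCA.
have mW1 y : measurable_fun setT
    (fun x => (W x * \1_(X @^-1` (h @^-1` [set y])) x)%:E).
  by apply/measurable_EFinP; apply: measurable_funM => //; exact: measurable_indic.
rewrite ge0_integral_fsum//; last 2 first.
- by move=> y; under eq_fun do rewrite EFinM; exact: measurable_funeM.
- move=> y x _; rewrite lee_fin mulrCA mulr_ge0// indicE.
  by case: (boolP (_ \in _)) => [/set_mem/= <-|]; rewrite ?mulr1 ?mulr0.
rewrite integralT_nnsfun sintegralE; apply: eq_fsbigr => y /[!inE] -[s _ <-].
under [RHS]eq_integral do rewrite EFinM.
rewrite ge0_integralZl_EFin//; last by move=> x _; rewrite lee_fin mulr_ge0.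
congr (_ * _); rewrite nuE; last exact: measurable_funPTI.
by rewrite integral_mkcond epatch_indic.
Qed.

Lemma ge0_integral_weighted_image (g : S -> \bar R) :
  measurable_fun setT g -> (forall y, 0 <= g y) ->
  \int[nu]_y g y = \int[mu]_x ((W x)%:E * g (X x)).
Proof.
move=> mg g0; set h := nnsfun_approx measurableT mg.
have h_cvg y : EFin \o h ^~ y @ \oo --> g y by exact: cvg_nnsfun_approx.
have h_homo y : {homo h ^~ y : m n / (m <= n)%N >-> (m <= n)%R}.
  by move=> m n mn; exact/lefP/nd_nnsfun_approx.
rewrite (nd_ge0_integral_lim nu g0 h_homo h_cvg).
transitivity (\int[mu]_x limn (fun n => (W x * h n (X x))%:E)); last first.
  apply: eq_integral => x _; apply/cvg_lim => //.
  by under eq_fun do rewrite EFinM; apply: cvgeZl => //; exact: h_cvg.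
rewrite monotone_convergence//.
- congr (limn _); apply/funext => n /=.
  by rewrite -integralT_nnsfun integral_weighted_image_nnsfun.
- move=> n; apply/measurable_EFinP; apply: measurable_funM => //.
  exact: measurableT_comp.
- by move=> n x _; rewrite lee_fin mulr_ge0.
- by move=> x _ m n mn; rewrite lee_fin ler_wpM2l// h_homo.
Qed.

End weighted_image.

Section independence.
Local Open Scope ereal_scope.
Context {R : realType} d d' (T : measurableType d) (S : measurableType d').
Variable P : probability T R.

Definition mutually_independent n (X : 'I_n -> T -> S) :=
  forall B : 'I_n -> set S, (forall i, measurable (B i)) ->
  P (\bigcap_(i in [set: 'I_n]) (X i @^-1` B i)) = \prod_(i < n) P (X i @^-1` B i).

Lemma ge0_integral_indep_weight (Y : T -> S) (W : T -> R) (c : {nonneg R}) (g : S -> \bar R) :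
  measurable_fun setT Y -> measurable_fun setT W -> (forall w, 0 <= W w)%R ->
  (forall B, measurable B ->
    \int[P]_w (W w * \1_(Y @^-1` B) w)%:E = c%:num%:E * P (Y @^-1` B)) ->
  measurable_fun setT g -> (forall y, 0 <= g y) ->
  \int[P]_w ((W w)%:E * g (Y w)) = c%:num%:E * \int[P]_w g (Y w).
Proof.
move=> mY mW W0 WY mg g0.
rewrite -[X in _ * X](@ge0_integral_pushforward _ _ _ _ _ _ mY P setT g)//.
rewrite -ge0_integral_mscale//; apply/esym.
apply: ge0_integral_weighted_image => // B mB.
by rewrite integral_mkcond epatch_indic; exact/esym/WY.
Qed.

Variables (n : nat) (X : 'I_n -> T -> S).
Hypotheses (mX : forall i, measurable_fun setT (X i)) (indep : mutually_independent X).

Let measurable_preimage i B : measurable B -> measurable (X i @^-1` B).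
Proof. by move=> mB; rewrite -[X in measurable X]setTI; exact: mX. Qed.

Let integral_indic_preimage i B : measurable B ->
  \int[P]_w (\1_B (X i w))%:E = P (X i @^-1` B).
Proof.
move=> mB; rewrite -[LHS]/(\int[P]_w (\1_(X i @^-1` B) w)%:E).
by rewrite integral_indic ?setIT//; exact: measurable_preimage.
Qed.

Definition expectation_factorizes (g : 'I_n -> S -> R) :=
  \int[P]_w (\prod_(i < n) g i (X i w))%:E = \prod_(i < n) \int[P]_w (g i (X i w))%:E.

Lemma expectation_factorizes_indic (B : 'I_n -> set S) :
  (forall i, measurable (B i)) -> expectation_factorizes (fun i => \1_(B i)).
Proof.
move=> mB; pose E := \bigcap_(i in [set: 'I_n]) (X i @^-1` B i).
have mE : measurable E.
  by apply: fin_bigcap_measurable => [|i _]; [exact: finite_finset|exact: measurable_preimage].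
transitivity (\int[P]_w (\1_E w)%:E); last first.
  rewrite integral_indic// setIT [LHS]indep//; apply: eq_bigr => i _.
  by rewrite integral_indic_preimage.
apply: eq_integral => w _; congr EFin; rewrite indicE.
have [/set_mem Ew|] := boolP (w \in E).
  by rewrite big1// => i _; rewrite indicE mem_set//; exact: Ew.
rewrite notin_setE => /existsNP[i /not_implyP[_ nBi]]; apply/eqP.
by rewrite prodf_seq_eq0; apply/hasP; exists i; rewrite ?mem_index_enum//= indicE memNset.
Qed.

Lemma expectation_factorizes_from_indic (g : 'I_n -> S -> R) (j : 'I_n) :
  (forall i, measurable_fun setT (g i)) -> (forall i y, 0 <= g i y)%R ->
  (forall i, \int[P]_w (g i (X i w))%:E < +oo) ->
  (forall B, measurable B -> expectation_factorizes [eta g with j |-> \1_B]) ->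
  expectation_factorizes g.
Proof.
move=> mg g0 goo g_indic; rewrite /expectation_factorizes.
pose W w := (\prod_(i < n | i != j) g i (X i w))%R.
pose C := \prod_(i < n | i != j) \int[P]_w (g i (X i w))%:E.
have Eg_ge0 i : 0 <= \int[P]_w (g i (X i w))%:E.
  by apply: integral_ge0 => w _; rewrite lee_fin.
have C_ge0 : 0 <= C by exact: prode_ge0.
have C_fin : C \is a fin_num by apply: prode_fin_num => i _; rewrite ge0_fin_numE.
have mW : measurable_fun setT W.
  rewrite /W; under eq_fun do rewrite -big_filter.
  by apply: measurable_prod => i _; exact: measurableT_comp.
have W_indep B : measurable B ->
    \int[P]_w (W w * \1_(X j @^-1` B) w)%:E = C * P (X j @^-1` B).
  move=> mB; have := g_indic _ mB; rewrite /expectation_factorizes.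
  rewrite [X in _ = X](bigD1 j)//= eqxx integral_indic_preimage// muleC.
  under [X in _ = X * _ -> _]eq_bigr => i /negbTE ij do rewrite ij.
  move=> gB.
  rewrite -gB; apply: eq_integral => w _; rewrite [in RHS](bigD1 j)//= eqxx mulrC.
  by congr (_ * _)%:E; apply: eq_bigr => i /negbTE ->.
rewrite (bigD1 j)//= -/C muleC -(fineK C_fin).
rewrite -(@ge0_integral_indep_weight (X j) W (NngNum (fine_ge0 C_ge0)) (EFin \o g j))//=.
- by apply: eq_integral => w _; rewrite (bigD1 j)//= EFinM muleC.
- by move=> w; exact: prodr_ge0.
- by move=> B mB; rewrite fineK// W_indep.
- exact/measurable_EFinP.
- by move=> y; rewrite lee_fin.
Qed.

Lemma ge0_expectation_factorizes (g : 'I_n -> S -> R) :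
  (forall i, measurable_fun setT (g i)) -> (forall i y, 0 <= g i y)%R ->
  (forall i, \int[P]_w (g i (X i w))%:E < +oo) -> expectation_factorizes g.
Proof.
(* All factors of rank at least [k] are indicators; raising [k] frees them one at a time. *)
suff factorizes_rank k (h : 'I_n -> S -> R) : (forall i, measurable_fun setT (h i)) ->
    (forall i y, 0 <= h i y)%R -> (forall i, \int[P]_w (h i (X i w))%:E < +oo) ->
    (forall i : 'I_n, (k <= i)%N -> exists2 B, measurable B & h i = \1_B) ->
    expectation_factorizes h.
  move=> mg g0 goo; apply: (factorizes_rank n) => // i.
  by rewrite leqNgt ltn_ord.
elim: k h => [|k IH] h mh h0 hoo h_indic.
  have /choice[B h_eq] : forall i, exists B, measurable B /\ h i = \1_B.
    by move=> i; have [B] := h_indic i (leq0n _); exists B.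
  have -> : h = fun i => \1_(B i) by apply/funext => i; exact: (h_eq i).2.
  by apply: expectation_factorizes_indic => i; exact: (h_eq i).1.
have [kn|nk] := ltnP k n; last first.
  by apply: IH => // i ki; have := ltn_ord i; rewrite ltnNge (leq_trans nk).
apply: (@expectation_factorizes_from_indic h (Ordinal kn)) => // B mB; apply: IH.
- by move=> i /=; case: ifPn.
- by move=> i y /=; case: ifPn.
- move=> i /=; case: ifPn => // _.
  by rewrite integral_indic_preimage// ltey_eq fin_num_measure//; exact: measurable_preimage.
- move=> i ki /=; case: ifPn => [_|i_neq]; first by exists B.
  by apply: h_indic; rewrite ltn_neqAle ki andbT eq_sym.
Qed.

End independence.

Section hellinger_affinity.
Local Open Scope ereal_scope.
Context {R : realType} dS (S : measurableType dS) (mu : {measure set S -> \bar R}).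
Implicit Types p q r : S -> R.

Definition density p :=
  [/\ measurable_fun setT p, forall x, (0 <= p x)%R & \int[mu]_x (p x)%:E = 1].

Definition positive_density p := density p /\ forall x, (0 < p x)%R.

Definition hellinger_sqr p q :=
  \int[mu]_x ((Num.sqrt (p x) - Num.sqrt (q x)) ^+ 2)%:E.

Definition affinity p q := \int[mu]_x (Num.sqrt (p x * q x))%:E.

Definition mean_likelihood_ratio p q := \int[mu]_x (p x ^+ 2 / q x)%:E.

Lemma measurable_sqrtr p : measurable_fun setT p ->
  measurable_fun setT (fun x => Num.sqrt (p x)).
Proof.
by apply: measurableT_comp; apply: continuous_measurable_fun; exact: sqrt_continuous.
Qed.

Lemma measurable_affinity p q : measurable_fun setT p -> measurable_fun setT q ->
  measurable_fun setT (fun x => (Num.sqrt (p x * q x))%:E).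
Proof.
by move=> mp mq; apply/measurable_EFinP/measurable_sqrtr; exact: measurable_funM.
Qed.

Lemma measurable_hellinger_sqr p q : measurable_fun setT p -> measurable_fun setT q ->
  measurable_fun setT (fun x => ((Num.sqrt (p x) - Num.sqrt (q x)) ^+ 2)%:E).
Proof.
move=> mp mq; apply/measurable_EFinP/measurable_funX.
by apply: measurable_funB; exact: measurable_sqrtr.
Qed.

Lemma hellinger_sqr_ge0 p q : 0 <= hellinger_sqr p q.
Proof. by apply: integral_ge0 => x _; rewrite lee_fin sqr_ge0. Qed.

Lemma affinity_ge0 p q : 0 <= affinity p q.
Proof. by apply: integral_ge0 => x _; rewrite lee_fin sqrtr_ge0. Qed.

Lemma hellinger_sqrD_affinity p q : density p -> density q ->
  hellinger_sqr p q + 2%:E * affinity p q = 2%:E.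
Proof.
move=> [mp p0 p1] [mq q0 q1].
have m_aff := measurable_affinity mp mq.
have aff_ge0 x : setT x -> 0 <= (Num.sqrt (p x * q x))%:E by rewrite lee_fin sqrtr_ge0.
rewrite -ge0_integralZl_EFin// -ge0_integralD//; last 3 first.
- by move=> x _; rewrite lee_fin sqr_ge0.
- exact: measurable_hellinger_sqr.
- exact: measurable_funeM.
transitivity (\int[mu]_x ((p x)%:E + (q x)%:E)).
  apply: eq_integral => x _; rewrite -EFinM -!EFinD sqrtrM//; congr EFin.
  by rewrite -[in RHS](sqr_sqrtr (p0 x)) -[in RHS](sqr_sqrtr (q0 x)); ring.
rewrite ge0_integralD ?p1 ?q1 -?EFinD//.
- by move=> x _; rewrite lee_fin.
- exact/measurable_EFinP.
- by move=> x _; rewrite lee_fin.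
- exact/measurable_EFinP.
Qed.

Lemma hellinger_sqr_fin_num p q : density p -> density q ->
  hellinger_sqr p q \is a fin_num.
Proof.
move=> dp dq; rewrite ge0_fin_numE ?hellinger_sqr_ge0//.
rewrite (@le_lt_trans _ _ 2%:E) ?ltry// -(hellinger_sqrD_affinity dp dq) leeDl//.
by rewrite mule_ge0 ?affinity_ge0.
Qed.

Lemma affinityE p q : density p -> density q ->
  affinity p q = (1 - fine (hellinger_sqr p q) / 2)%:E.
Proof.
move=> dp dq; have := hellinger_sqrD_affinity dp dq.
rewrite -(fineK (hellinger_sqr_fin_num dp dq)) /=.
have := affinity_ge0 p q; case: (affinity p q) => [a _|_|//] /=.
  by rewrite -EFinM -EFinD => -[h2a]; congr EFin; lra.
by rewrite mulry gtr0_sg// mul1e addey.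
Qed.

Lemma hellinger_sqr_quasi_triangle p q r :
  measurable_fun setT p -> measurable_fun setT q -> measurable_fun setT r ->
  hellinger_sqr p r <= 2%:E * hellinger_sqr p q + 2%:E * hellinger_sqr q r.
Proof.
move=> mp mq mr.
have gap_ge0 u v x : 0 <= ((Num.sqrt (u x) - Num.sqrt (v x)) ^+ 2)%:E.
  by rewrite lee_fin sqr_ge0.
have m_gap := measurable_hellinger_sqr.
rewrite -!ge0_integralZl_EFin//; try exact: m_gap; try by move=> x _; exact: gap_ge0.
rewrite -ge0_integralD//; try exact/measurable_funeM/m_gap;
  try by move=> x _; rewrite mule_ge0// gap_ge0.
apply: ge0_le_integral => //.
- by move=> x _; exact: gap_ge0.
- exact: m_gap.
- by apply: emeasurable_funD; exact/measurable_funeM/m_gap.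
- move=> x _; rewrite -!EFinM -EFinD lee_fin.
  have := sqr_ge0 (Num.sqrt (p x) - Num.sqrt (q x) - (Num.sqrt (q x) - Num.sqrt (r x))).
  by nra.
Qed.

Lemma affinity_ge_expR p q (m : R) : density p -> measurable_fun setT q ->
  (forall x, p x <= expR m * q x)%R -> (expR (- (m / 2)))%:E <= affinity p q.
Proof.
move=> [mp p0 p1] mq pq.
have mpE : measurable_fun setT (fun x => (p x)%:E) by exact/measurable_EFinP.
rewrite -[leLHS]mule1 -p1 -ge0_integralZl_EFin ?expR_ge0//; last first.
  by move=> x _; rewrite lee_fin.
apply: ge0_le_integral => //.
- by move=> x _; rewrite -EFinM lee_fin mulr_ge0 ?expR_ge0.
- exact: measurable_funeM.
- exact: measurable_affinity.
- move=> x _; rewrite -EFinM lee_fin.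
  have scaled_p_ge0 : (0 <= expR (- (m / 2)) * p x)%R by rewrite mulr_ge0 ?expR_ge0.
  rewrite -[leLHS](ger0_norm scaled_p_ge0) -sqrtr_sqr ler_wsqrtr//.
  rewrite exprMn -expRM_natl (_ : 2 * - (m / 2) = - m)%R; last by field.
  by rewrite expRN expr2 mulrCA ler_wpM2l// ler_pdivrMl ?expR_gt0.
Qed.

Lemma hellinger_sqr_le_log_ratio p q (m : R) : density p -> density q ->
  (forall x, p x <= expR m * q x)%R -> (fine (hellinger_sqr p q) <= m)%R.
Proof.
move=> dp dq pq; have [mq _ _] := dq; have := affinity_ge_expR dp mq pq.
by rewrite affinityE// lee_fin => aff_ge; have := expR_ge1Dx (- (m / 2)); lra.
Qed.

Lemma affinity_le_of_hellinger_sqr_ge p q r (m h : R) : density p -> density q -> density r ->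
  (forall x, p x <= expR m * q x)%R -> (h <= fine (hellinger_sqr p r))%R ->
  affinity q r <= (expR (m / 2 - h / 4))%:E.
Proof.
move=> dp dq dr pq far; rewrite affinityE// lee_fin; apply: le_trans (expR_ge1Dx _).
have pq_close := hellinger_sqr_le_log_ratio dp dq pq.
have [[mp _ _] [mq _ _] [mr _ _]] := And3 dp dq dr.
have := hellinger_sqr_quasi_triangle mp mq mr.
rewrite -[hellinger_sqr p r]fineK ?hellinger_sqr_fin_num//.
rewrite -[hellinger_sqr p q]fineK ?hellinger_sqr_fin_num//.
rewrite -[hellinger_sqr q r]fineK ?hellinger_sqr_fin_num//.
by rewrite -!EFinM -EFinD lee_fin; lra.
Qed.

Lemma mean_likelihood_ratio_le p q r (c : R) : (0 <= c)%R ->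
  measurable_fun setT p -> positive_density q -> density r ->
  (forall x, p x ^+ 2 <= c * r x * q x)%R ->
  mean_likelihood_ratio p q <= c%:E.
Proof.
move=> c0 mp [[mq _ _] q0] [mr r0 r1] p2_le.
have mrE : measurable_fun setT (fun x => (r x)%:E) by exact/measurable_EFinP.
rewrite -[leRHS]mule1 -r1 -ge0_integralZl_EFin//; last by move=> x _; rewrite lee_fin.
apply: ge0_le_integral => //.
- by move=> x _; rewrite lee_fin divr_ge0 ?sqr_ge0// ltW.
- apply/measurable_EFinP; apply: measurable_funM; first exact: measurable_funX.
  under eq_fun do rewrite -powR_inv1 ?(ltW (q0 _))//.
  exact: measurableT_comp (measurable_powR _) mq.
- exact: measurable_funeM.
- by move=> x _; rewrite -EFinM lee_fin ler_pdivrMr.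
Qed.

End hellinger_affinity.

Section likelihood.
Local Open Scope ereal_scope.
Context {R : realType} dS (S : measurableType dS) (mu : {measure set S -> \bar R}).
Context dO (Omega : measurableType dO) (P : probability Omega R).

Definition has_law_density (Y : Omega -> S) (p : S -> R) :=
  forall B, measurable B -> P (Y @^-1` B) = \int[mu]_(x in B) (p x)%:E.

Definition log_likelihood n (X : 'I_n -> Omega -> S) (q : S -> R) (w : Omega) : R :=
  (\sum_(i < n) ln (q (X i w)))%R.

Lemma measurable_ln_comp (q : S -> R) : measurable_fun setT q ->
  measurable_fun setT (fun x => ln (q x)).
Proof. exact: measurableT_comp (@measurable_ln R). Qed.

Lemma measurable_log_likelihood n (X : 'I_n -> Omega -> S) q :
  (forall i, measurable_fun setT (X i)) -> measurable_fun setT q ->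
  measurable_fun setT (log_likelihood X q).
Proof.
move=> mX mq; apply: measurable_sum => i.
exact: (measurableT_comp (measurable_ln_comp mq) (mX i)).
Qed.

Lemma ge0_integral_law (Y : Omega -> S) (p : S -> R) (g : S -> \bar R) :
  measurable_fun setT Y -> density mu p -> has_law_density Y p ->
  measurable_fun setT g -> (forall x, 0 <= g x) ->
  \int[P]_w g (Y w) = \int[mu]_x ((p x)%:E * g x).
Proof.
move=> mY [mp p0 _] Yp mg g0.
rewrite -[LHS](@ge0_integral_pushforward _ _ _ _ _ _ mY P setT g)//.
exact: (@ge0_integral_weighted_image _ _ _ _ _ mu _ id p).
Qed.

Variables (n : nat) (X : 'I_n -> Omega -> S) (p : S -> R).
Hypothesis mX : forall i, measurable_fun setT (X i).
Hypothesis indep : mutually_independent P X.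
Hypothesis lawX : forall i, has_law_density (X i) p.
Hypothesis dp : positive_density mu p.

Lemma sample_sum_chernoff (ell : S -> R) (a t : R) : measurable_fun setT ell ->
  \int[mu]_x (p x * expR (ell x))%:E <= (expR a)%:E ->
  P [set w | (t <= \sum_(i < n) ell (X i w))%R] <= (expR (n%:R * a - t))%:E.
Proof.
move=> mell mgf_le; have [dp' _] := dp; have [_ p0 _] := dp'.
have me : measurable_fun setT (fun x => expR (ell x)) by exact: measurableT_comp.
have Ee i : \int[P]_w (expR (ell (X i w)))%:E = \int[mu]_x (p x * expR (ell x))%:E.
  rewrite (@ge0_integral_law (X i) p (fun x => (expR (ell x))%:E))//.
  exact/measurable_EFinP.
have mgf_ge0 : 0 <= \int[mu]_x (p x * expR (ell x))%:E.
  by apply: integral_ge0 => x _; rewrite lee_fin mulr_ge0 ?expR_ge0.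
have mgf_sum_le :
    \int[P]_w (expR (\sum_(i < n) ell (X i w))%R)%:E <= (expR (n%:R * a))%:E.
  under eq_integral do rewrite expR_sum.
  rewrite [leLHS](ge0_expectation_factorizes mX indep (g := fun=> expR \o ell))//;
    last 2 first.
  - by move=> i x; exact: expR_ge0.
  - by move=> i; rewrite Ee (le_lt_trans mgf_le)// ltry.
  under eq_bigr do rewrite Ee.
  move: mgf_le mgf_ge0; case: (integral mu _ _) => [e|//|//]; rewrite !lee_fin => ea e0.
  by rewrite prodEFin prodr_const card_ord lee_fin expRM_natl lerXn2r ?nnegrE ?expR_ge0.
have msum : measurable_fun setT (fun w => \sum_(i < n) ell (X i w))%R.
  by apply: measurable_sum => i; exact: (measurableT_comp mell (mX i)).
pose sum_ell : {RV P >-> R} := HB.pack (fun w => \sum_(i < n) ell (X i w))%R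
  (isMeasurableFun.Build _ _ _ _ _ msum).
apply: (le_trans (chernoff sum_ell t ltr01)).
rewrite mul1r expRD EFinM lee_wpmul2r ?lee_fin ?expR_ge0//.
rewrite /mmt_gen_fun unlock; apply: le_trans mgf_sum_le.
by under eq_integral do rewrite /= mulr1.
Qed.

Lemma log_likelihood_loss_deviation (r : S -> R) (a t : R) :
  positive_density mu r -> mean_likelihood_ratio mu p r <= (expR a)%:E ->
  P [set w | (t <= log_likelihood X p w - log_likelihood X r w)%R]
    <= (expR (n%:R * a - t))%:E.
Proof.
move=> [[mr _ _] r0] ratio_le; have [[mp _ _] p0] := dp.
under eq_set do rewrite -sumrB.
apply: (@sample_sum_chernoff (fun x => ln (p x) - ln (r x))%R).
  by apply: measurable_funB; exact: measurable_ln_comp.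
under eq_integral do rewrite expRD expRN !lnK ?posrE// mulrA -expr2.
exact: ratio_le.
Qed.

Lemma log_likelihood_gain_deviation (q : S -> R) (a t : R) :
  positive_density mu q -> affinity mu q p <= (expR a)%:E ->
  P [set w | (t <= log_likelihood X q w - log_likelihood X p w)%R]
    <= (expR (n%:R * a - t / 2))%:E.
Proof.
move=> [[mq _ _] q0] aff; have [[mp _ _] p0] := dp.
pose ell x := (2^-1 * (ln (q x) - ln (p x)))%R.
have -> : [set w | (t <= log_likelihood X q w - log_likelihood X p w)%R] =
    [set w | (t / 2 <= \sum_(i < n) ell (X i w))%R].
  by apply: eq_set => w; rewrite -mulr_sumr -sumrB [in RHS]mulrC ler_pM2l.
apply: sample_sum_chernoff.
  by apply: measurable_funM => //; apply: measurable_funB; exact: measurable_ln_comp.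
suff p_expR x : (p x * expR (ell x) = Num.sqrt (q x * p x))%R.
  by under eq_integral do rewrite p_expR.
have p_expR_ge0 : (0 <= p x * expR (ell x))%R by rewrite mulr_ge0 ?expR_ge0// ltW.
rewrite -[LHS]ger0_norm// -sqrtr_sqr; congr Num.sqrt.
rewrite exprMn -expRM_natl mulrA divff// mul1r expRD expRN !lnK ?posrE//.
by field; rewrite gt_eqF.
Qed.

End likelihood.

Section approximate_mle.
Local Open Scope ereal_scope.
Context {R : realType}.

Lemma measure_bigsetU_le_card d (T : ringOfSetsType d) (mu : {content set T -> \bar R})
    (I : finType) (D : pred I) (A : I -> set T) (c : R) : (0 <= c)%R ->
  (forall i, D i -> measurable (A i)) -> (forall i, D i -> mu (A i) <= c%:E) ->
  mu (\big[setU/set0]_(i | D i) A i) <= (#|I|%:R * c)%:E.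
Proof.
move=> c0 mA Ac; apply: (@le_trans _ _ (\sum_(i | D i) c%:E)); last first.
  rewrite sumEFin sumr_const lee_fin -[leLHS]mulr_natl ler_wpM2r// ler_nat.
  exact: max_card.
suff [] : measurable (\big[setU/set0]_(i | D i) A i) /\
  mu (\big[setU/set0]_(i | D i) A i) <= \sum_(i | D i) c%:E by [].
elim/big_rec2: _ => [|i a U Di [mU Ua]]; first by rewrite measure0.
split; first by apply: measurableU => //; exact: mA.
by rewrite (le_trans (measureU2 _ _ _))//; [exact: mA|exact: leeD (Ac i Di) Ua].
Qed.

Context dS (S : measurableType dS) (mu : {measure set S -> \bar R}).
Context dO (Omega : measurableType dO) (P : probability Omega R).
Variables (n : nat) (X : 'I_n -> Omega -> S) (p : S -> R).
Hypothesis mX : forall i, measurable_fun setT (X i).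
Hypothesis indep : mutually_independent P X.
Hypothesis lawX : forall i, has_law_density mu P (X i) p.
Hypothesis dp : positive_density mu p.

Lemma measurable_log_likelihood_ge (q r : S -> R) (t : R) :
  measurable_fun setT q -> measurable_fun setT r ->
  measurable [set w | (t <= log_likelihood X q w - log_likelihood X r w)%R].
Proof.
move=> mq mr; rewrite -[X in measurable X]setTI; apply: measurable_fun_le => //.
by apply: measurable_funB; exact: measurable_log_likelihood.
Qed.

Lemma log_likelihood_le (q r : S -> R) (m : R) w :
  (forall x, 0 < q x)%R -> (forall x, 0 < r x)%R ->
  (forall x, q x <= expR m * r x)%R ->
  (log_likelihood X q w <= n%:R * m + log_likelihood X r w)%R.
Proof.
move=> q0 r0 qr.
have -> : (n%:R * m + log_likelihood X r w =
    \sum_(i < n) (m + ln (r (X i w))))%R.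
  by rewrite big_split/= sumr_const card_ord mulr_natl.
apply: ler_sum => i _; rewrite -[X in (X + _)%R]expRK -lnM ?posrE ?expR_gt0//.
by rewrite ler_ln ?posrE ?mulr_gt0 ?expR_gt0.
Qed.

(* Off the exceptional set, every [q i] far from [p] has a log-likelihood below that of [p]
   by [n (m + eps^2 / 3)], while the approximant [r] loses at most [n eps^2 / 6]. *)
Theorem approximate_mle_deviation (I : finType) (q : I -> S -> R) (r : S -> R)
    (phat : Omega -> S -> R) (m a eps eta : R) :
  (forall i, positive_density mu (q i)) -> positive_density mu r ->
  (forall w, positive_density mu (phat w)) ->
  mean_likelihood_ratio mu p r <= (expR a)%:E ->
  (forall w, exists i, forall x, (phat w x <= expR m * q i x)%R) ->
  (forall w, log_likelihood X r w - eta <= log_likelihood X (phat w) w)%R ->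
  (eta <= n%:R * (eps ^+ 2 / 6))%R ->
  exists E : set Omega, [/\ measurable E,
    [set w | (eps ^+ 2 < fine (hellinger_sqr mu (phat w) p))%R] `<=` E &
    P E <= (#|I|%:R * expR (n%:R * (m - eps ^+ 2 / 12)) +
            expR (n%:R * (a - eps ^+ 2 / 6)))%:E].
Proof.
move=> dq dr dphat ratio_le dominated mle eta_le.
have [[mp _ _] _] := dp; have [[mr _ _] _] := dr.
pose far i := `[< affinity mu (q i) p <= (expR (m / 2 - eps ^+ 2 / 4))%:E >].
pose likely i := [set w | (- (n%:R * (m + eps ^+ 2 / 3)) <=
  log_likelihood X (q i) w - log_likelihood X p w)%R].
pose poor := [set w | (n%:R * (eps ^+ 2 / 6) <=
  log_likelihood X p w - log_likelihood X r w)%R].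
have m_likely i : measurable (likely i).
  by apply: measurable_log_likelihood_ge => //; have [[]] := dq i.
have m_poor : measurable poor by exact: measurable_log_likelihood_ge.
have P_likely i : far i -> P (likely i) <= (expR (n%:R * (m - eps ^+ 2 / 12)))%:E.
  move=> /asboolP aff_le.
  have := log_likelihood_gain_deviation mX indep lawX dp _ (dq i) aff_le.
  by move=> /(_ _)/le_trans; apply; rewrite lee_fin ler_expR; lra.
exists (\big[setU/set0]_(i | far i) likely i `|` poor); split.
- by apply: measurableU => //; apply: bigsetU_measurable => i _.
- move=> w /= far_w; have [i phat_le] := dominated w.
  have [dphat_w phat0] := dphat w; have [dqi qi0] := dq i.
  have far_i : far i.
    apply/asboolP.
    exact: affinity_le_of_hellinger_sqr_ge dphat_w dqi dp.1 phat_le (ltW far_w).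
  have [poor_w|not_poor] := leP (n%:R * (eps ^+ 2 / 6))%R
    (log_likelihood X p w - log_likelihood X r w)%R; [by right|left].
  rewrite -bigcup_seq_cond; exists i; first by rewrite /= mem_index_enum.
  have := log_likelihood_le w phat0 qi0 phat_le; have := mle w.
  by rewrite /likely /=; lra.
- rewrite (le_trans (measureU2 _ _ _))//.
    by apply: bigsetU_measurable => i _.
  rewrite EFinD leeD//.
    by apply: measure_bigsetU_le_card => //; exact: expR_ge0.
  have := log_likelihood_loss_deviation mX indep lawX dp _ dr ratio_le.
  by move=> /(_ _)/le_trans; apply; rewrite lee_fin ler_expR mulrBr.
Qed.

End approximate_mle.

Section lebesgue_tuple.
Context {R : realType}.

Lemma sigma_finite_pushforward d d' (T : measurableType d) (S : measurableType d')
    (mu : {measure set T -> \bar R}) (f : T -> S) (g : S -> T) :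
  measurable_fun setT g -> cancel f g -> sigma_finite setT mu ->
  sigma_finite setT (pushforward mu f).
Proof.
move=> mg fK [F FT mF]; exists (fun i => g @^-1` F i).
  by rewrite -preimage_bigcup -FT.
move=> i; have [mFi Fioo] := mF i.
split; first by rewrite -[X in measurable X]setTI; exact: mg.
by rewrite /pushforward -comp_preimage (_ : g \o f = id) ?preimage_id//; exact/funext.
Qed.

(* The sigma-finite instance of [\x] is shadowed by the one for subprobabilities. *)
Lemma sigma_finite_product_measure d d' (T : measurableType d) (S : measurableType d')
    (mu : {sigma_finite_measure set T -> \bar R})
    (nu : {sigma_finite_measure set S -> \bar R}) : sigma_finite setT (mu \x nu)%E.
Proof.
have /sigma_finiteP[F [FT ndF mF]] := sigma_finiteT mu.
have /sigma_finiteP[G [GT ndG mG]] := sigma_finiteT nu.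
exists (fun i => F i `*` G i) => [|i].
  apply/seteqP; split => // -[x y] _.
  have [[i _ Fi] [j _ Gj]] : (\bigcup_i F i) x /\ (\bigcup_i G i) y by rewrite -FT -GT.
  exists (maxn i j) => //; split.
    by apply: (subsetPset _ _ (ndF i _ _)) Fi; exact: leq_maxl.
  by apply: (subsetPset _ _ (ndG j _ _)) Gj; exact: leq_maxr.
have [[mFi Fioo] [mGi Gioo]] := (mF i, mG i); split; first exact: measurableX.
by rewrite product_measure1E// lte_mul_pinfty// ge0_fin_numE.
Qed.

Definition cons_pair k (u : measurableTypeR R * k.-tuple R) : k.+1.-tuple R :=
  cons_tuple u.1 u.2.

Definition uncons_pair k (t : k.+1.-tuple R) : measurableTypeR R * k.-tuple R :=
  (thead t, [tuple of behead t]).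

Lemma cons_pairK k : cancel (@cons_pair k) (@uncons_pair k).
Proof. by move=> [x t]; congr pair; exact: val_inj. Qed.

Lemma measurable_cons_pair k : measurable_fun setT (@cons_pair k).
Proof. by apply: measurable_cons; [exact: measurable_fst|exact: measurable_snd]. Qed.

Lemma measurable_uncons_pair k : measurable_fun setT (@uncons_pair k).
Proof.
by apply: measurable_fun_pair; [exact: measurable_tnth|exact: measurable_behead].
Qed.

Section cons_measure.
Variables (k : nat) (mu : {sigma_finite_measure set (k.-tuple R) -> \bar R}).

Let leb : {sigma_finite_measure set (measurableTypeR R) -> \bar R} := @lebesgue_measure R.

Definition cons_measure : set (k.+1.-tuple R) -> \bar R :=
  pushforward (leb \x mu)%E (@cons_pair k).

Let cons_measure0 : cons_measure set0 = 0%E.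
Proof. by rewrite /cons_measure /pushforward preimage_set0 measure0. Qed.

Let cons_measure_ge0 A : (0 <= cons_measure A)%E.
Proof. by rewrite /cons_measure /pushforward. Qed.

Let cons_measure_sigma_additive : semi_sigma_additive cons_measure.
Proof. by apply: measure_semi_sigma_additive => //; exact: measurable_cons_pair. Qed.

HB.instance Definition _ := isMeasure.Build _ _ _ cons_measure
  cons_measure0 cons_measure_ge0 cons_measure_sigma_additive.

Let cons_measure_sigma_finite : sigma_finite setT cons_measure.
Proof.
apply: (sigma_finite_pushforward (@measurable_uncons_pair k) (@cons_pairK k)).
exact: sigma_finite_product_measure.
Qed.

HB.instance Definition _ := Measure_isSigmaFinite.Build _ _ _ cons_measure
  cons_measure_sigma_finite.

Lemma ge0_integral_cons_measure (g : k.+1.-tuple R -> \bar R) :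
  measurable_fun setT g -> (forall x, (0 <= g x)%E) ->
  (\int[cons_measure]_x g x = \int[lebesgue_measure]_x \int[mu]_t g (cons_tuple x t))%E.
Proof.
move=> mg g0; have mgc : measurable_fun setT (g \o @cons_pair k).
  by apply: measurableT_comp => //; exact: measurable_cons_pair.
rewrite -(@fubini_tonelli1 _ _ _ _ _ leb mu (g \o @cons_pair k))//.
  by rewrite -[RHS](@ge0_integral_pushforward _ _ _ _ _ _ (@measurable_cons_pair k) _ setT g).
by move=> u; exact: g0.
Qed.

End cons_measure.

Fixpoint tuple_lebesgue k : {sigma_finite_measure set (k.-tuple R) -> \bar R} :=
  if k is k'.+1 then cons_measure (tuple_lebesgue k') else @dirac _ (0.-tuple R) [tuple] R.

Lemma ge0_integral_tuple_lebesgueS k (g : k.+1.-tuple R -> \bar R) :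
  measurable_fun setT g -> (forall x, (0 <= g x)%E) ->
  (\int[tuple_lebesgue k.+1]_x g x =
   \int[@lebesgue_measure R]_x \int[tuple_lebesgue k]_t g (cons_tuple x t))%E.
Proof. exact: ge0_integral_cons_measure. Qed.

Lemma lebintE k (g : k.-tuple R -> \bar R) : measurable_fun setT g ->
  (forall x, (0 <= g x)%E) -> lebint g = (\int[tuple_lebesgue k]_x g x)%E.
Proof.
elim: k g => [|k IH] g mg g0; first by rewrite /= integral_dirac// diracT mul1e.
rewrite [RHS]ge0_integral_tuple_lebesgueS//; apply: eq_integral => x _.
rewrite [LHS]IH//; apply: (measurableT_comp mg).
exact: measurable_cons.
Qed.

End lebesgue_tuple.

Section gaussian_density.
Context {R : realType}.

Lemma measurable_prod_tnth k (h : 'I_k -> R -> R) :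
  (forall j, measurable_fun setT (h j)) ->
  measurable_fun setT (fun x : k.-tuple R => (\prod_(j < k) h j (tnth x j))%:E).
Proof.
move=> mh; apply/measurable_EFinP; apply: measurable_prod => j _.
exact: measurableT_comp (mh j) (measurable_tnth j).
Qed.

Lemma ge0_integral_tuple_lebesgue_prod k (h : 'I_k -> R -> R) :
  (forall j, measurable_fun setT (h j)) -> (forall j y, 0 <= h j y) ->
  (\int[tuple_lebesgue k]_x (\prod_(j < k) h j (tnth x j))%:E =
   \prod_(j < k) \int[@lebesgue_measure R]_y (h j y)%:E)%E.
Proof.
elim: k h => [|k IH] h mh h0.
  rewrite big_ord0; under eq_integral do rewrite big_ord0.
  by rewrite integral_cst//= diracT mul1e.
have prod_ge0 x : (0 <= (\prod_(j < k) h (lift ord0 j) (tnth x j))%:E)%E.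
  by rewrite lee_fin prodr_ge0.
rewrite ge0_integral_tuple_lebesgueS; last 2 first.
- exact: measurable_prod_tnth.
- by move=> x; rewrite lee_fin prodr_ge0.
rewrite [RHS]big_ord_recl -(IH (fun j => h (lift ord0 j)))// -ge0_integralZr//; last 3 first.
- by apply/measurable_EFinP; exact: mh.
- by move=> x _; rewrite lee_fin.
- by apply: integral_ge0 => x _; exact: prod_ge0.
apply: eq_integral => x _.
rewrite -ge0_integralZl_EFin//; last first.
  exact: (@measurable_prod_tnth k (fun j => h (lift ord0 j))).
apply: eq_integral => t _; rewrite big_ord_recl EFinM; congr (_ * _%:E)%E.
by apply: eq_bigr => j _; rewrite tnthS.
Qed.

Section fixed_dimension.
Context {D : nat}.
Implicit Types (s : R) (x m : D.-tuple R).

Lemma phi_tsub_prod s x m : 0 < s ->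
  phi s (tsub x m) = \prod_(j < D) normal_pdf (tnth m j) s (tnth x j).
Proof.
move=> s0; under eq_bigr do rewrite normal_pdfE ?gt_eqF//.
rewrite big_split/= prodr_const card_ord /phi; congr (_ * _).
  by rewrite /normal_peak (_ : s ^+ 2 * pi *+ 2 = 2 * pi * s ^+ 2)//; ring.
rewrite /normal_fun -expR_sum; congr expR.
rewrite /sqnorm mulNr mulr_suml -sumrN; apply: eq_bigr => j _.
by rewrite tnth_mktuple mulNr (mulr_natl _ 2).
Qed.

Lemma phi_gt0 s x : 0 < s -> 0 < phi s x.
Proof.
move=> s0; rewrite /phi mulr_gt0 ?expR_gt0// exprn_gt0// invr_gt0 sqrtr_gt0.
by rewrite !mulr_gt0// ?pi_gt0// exprn_gt0.
Qed.

Lemma phi_le s x : phi s x <= (Num.sqrt (2 * pi * s ^+ 2))^-1 ^+ D.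
Proof.
rewrite /phi ler_piMr ?exprn_ge0 ?invr_ge0 ?sqrtr_ge0//.
rewrite -[leRHS]expR0 ler_expR mulNr oppr_le0 divr_ge0 ?sumr_ge0//.
  by move=> j _; rewrite sqr_ge0.
by rewrite mulr_ge0// sqr_ge0.
Qed.

Lemma measurable_phi_tsub d (T : measurableType d) s (X Y : T -> D.-tuple R) :
  measurable_fun setT X -> measurable_fun setT Y ->
  measurable_fun setT (fun t => (phi s (tsub (X t) (Y t)))%:E).
Proof.
move=> /measurable_fun_tnthP mX /measurable_fun_tnthP mY.
apply/measurable_EFinP; apply: measurable_funM => //.
apply: measurableT_comp => //; apply: measurable_funM => //.
apply: measurableT_comp => //; apply: measurable_sum => j.
under eq_fun do rewrite tnth_mktuple.
by apply: measurable_funX; apply: measurable_funB; [exact: mX|exact: mY].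
Qed.

Lemma integral_phi_tsub s m : 0 < s ->
  (\int[tuple_lebesgue D]_x (phi s (tsub x m))%:E = 1)%E.
Proof.
move=> s0; under eq_integral do rewrite phi_tsub_prod//.
rewrite (ge0_integral_tuple_lebesgue_prod (h := fun j => normal_pdf (tnth m j) s)) => [|j|j y].
- by rewrite big1// => j _; exact: integral_normal_pdf.
- exact: measurable_normal_pdf.
- exact: normal_pdf_ge0.
Qed.

End fixed_dimension.

End gaussian_density.

Section gaussian_comparison.
Context {R : realType}.

Lemma sqr_shift_le (b u v : R) : 1 < b ->
  u ^+ 2 / b - (u - v) ^+ 2 <= v ^+ 2 / (b - 1).
Proof.
move=> b1; have b0 : 0 < b by exact: lt_trans b1.
have b10 : 0 < b - 1 by rewrite subr_gt0.
rewrite -subr_ge0 (_ : _ - _ = ((b - 1) * u - b * v) ^+ 2 / (b * (b - 1))).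
  by rewrite divr_ge0 ?sqr_ge0// mulr_ge0 ?ltW.
by field; rewrite !gt_eqF.
Qed.

Lemma normal_pdf_le_scale (s r rho m c x : R) : 0 < s -> 1 < r -> `|m - c| <= rho * s ->
  normal_pdf m s x <=
  r * expR (rho ^+ 2 / (2 * (r ^+ 2 - 1))) * normal_pdf c (r * s) x.
Proof.
move=> s0 r1 mc; have r0 : 0 < r by exact: lt_trans r1.
have rr1 : 1 < r ^+ 2 by exact: exprn_egt1.
rewrite !normal_pdfE ?gt_eqF ?mulr_gt0//.
have -> : normal_peak s = r * normal_peak (r * s) :> R.
  have peak_scale : (r * s) ^+ 2 * pi *+ 2 = r ^+ 2 * (s ^+ 2 * pi *+ 2) by ring.
  rewrite /normal_peak peak_scale.
  by rewrite sqrtrM ?sqr_ge0// sqrtr_sqr gtr0_norm// invfM mulrA divff ?mul1r ?gt_eqF.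
rewrite [leRHS]mulrACA ler_wpM2l ?mulr_ge0 ?normal_peak_ge0 ?(ltW r0)//.
rewrite /normal_fun -expRD ler_expR.
pose u := (x - c) / s; pose v := (m - c) / s.
have v_le : v ^+ 2 / (r ^+ 2 - 1) <= rho ^+ 2 / (r ^+ 2 - 1).
  rewrite ler_pM2r ?invr_gt0 ?subr_gt0// -[leLHS]real_normK ?num_real//.
  have v_rho : `|v| <= rho by rewrite normrM normfV (gtr0_norm s0) ler_pdivrMr.
  by rewrite lerXn2r ?nnegrE// (le_trans _ v_rho).
have := sqr_shift_le u v rr1.
have -> : - (x - m) ^+ 2 / (s ^+ 2 *+ 2) = - (u - v) ^+ 2 / 2.
  by rewrite /u /v; field; rewrite gt_eqF.
have -> : - (x - c) ^+ 2 / ((r * s) ^+ 2 *+ 2) = - (u ^+ 2 / r ^+ 2) / 2.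
  by rewrite /u; field; rewrite !gt_eqF.
by rewrite [2 * _]mulrC invfM; lra.
Qed.

Lemma scale_factor_le (rho r : R) : 0 < rho -> 1 + rho <= r <= (1 + rho) ^+ 2 ->
  r * expR (rho ^+ 2 / (2 * (r ^+ 2 - 1))) <= expR (3 * rho).
Proof.
move=> rho0 /andP[r_ge r_le]; have r0 : 0 < r by lra.
rewrite (_ : 3 * rho = 2 * rho + rho) ?expRD; last by ring.
apply: ler_pM; rewrite ?expR_ge0 ?(ltW r0)//.
  rewrite (le_trans r_le)// expRM_natl lerXn2r ?nnegrE ?expR_ge0//; first lra.
  exact: expR_ge1Dx.
have rr_ge : 2 * rho <= r ^+ 2 - 1 by nra.
by rewrite ler_expR ler_pdivrMr; nra.
Qed.

Section fixed_dimension.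
Context {D : nat}.
Implicit Types (x a b m c : D.-tuple R).

Lemma phi_le_scale (s s' rho : R) x m c : 0 < s -> 0 < rho ->
  (1 + rho) * s <= s' <= (1 + rho) ^+ 2 * s ->
  (forall j, `|tnth m j - tnth c j| <= rho * s) ->
  phi s (tsub x m) <= expR (3 * rho * D%:R) * phi s' (tsub x c).
Proof.
move=> s0 rho0; rewrite -(ler_pdivlMr _ _ s0) -(ler_pdivrMr _ _ s0) => r_itv mc.
have r1 : 1 < s' / s by case/andP: r_itv; lra.
have r0 : 0 < s' / s by lra.
have s'E : s' = s' / s * s by rewrite divfK ?gt_eqF.
rewrite [3 * rho * _]mulrC expRM_natl [in leRHS]s'E.
rewrite !phi_tsub_prod ?(mulr_gt0 r0 s0)//.
rewrite -[X in _ ^+ X]card_ord -prodr_const -big_split/=.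
apply: ler_prod => j _; rewrite normal_pdf_ge0/=.
apply: le_trans (normal_pdf_le_scale _ s0 r1 (mc j)) _.
by rewrite ler_wpM2r ?normal_pdf_ge0// scale_factor_le.
Qed.

Definition reflection a b : D.-tuple R := [tuple 2 * tnth a j - tnth b j | j < D].

Lemma sqnorm_tsub_parallelogram x a b :
  sqnorm (tsub x (reflection a b)) + sqnorm (tsub x b) =
  2 * sqnorm (tsub x a) + 2 * sqnorm (tsub b a).
Proof.
rewrite /sqnorm !mulr_sumr -!big_split/=; apply: eq_bigr => j _.
by rewrite !tnth_mktuple; ring.
Qed.

Lemma sqnorm_tsub_le (del : R) a b :
  (forall j, `|tnth b j - tnth a j| <= del) -> sqnorm (tsub b a) <= D%:R * del ^+ 2.
Proof.
move=> ab; rewrite mulr_natl -[X in _ *+ X]card_ord -sumr_const.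
apply: ler_sum => j _; rewrite tnth_mktuple -real_normK ?num_real//.
by rewrite lerXn2r ?nnegrE// (le_trans _ (ab j)).
Qed.

Lemma phi_sqrE (s : R) x a b : 0 < s ->
  phi s (tsub x a) ^+ 2 =
  expR (sqnorm (tsub b a) / s ^+ 2) * phi s (tsub x (reflection a b)) * phi s (tsub x b).
Proof.
move=> s0; rewrite /phi.
have -> : sqnorm (tsub x a) =
    (sqnorm (tsub x (reflection a b)) + sqnorm (tsub x b)) / 2 - sqnorm (tsub b a).
  by rewrite sqnorm_tsub_parallelogram; field.
set C := _ ^-1 ^+ D; rewrite exprMn -expRM_natl.
rewrite [RHS](_ : _ = C ^+ 2 * (expR (sqnorm (tsub b a) / s ^+ 2) *
  expR (- sqnorm (tsub x (reflection a b)) / (2 * s ^+ 2)) *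
  expR (- sqnorm (tsub x b) / (2 * s ^+ 2)))); last by ring.
by rewrite -!expRD; congr (_ * expR _); field; rewrite gt_eqF.
Qed.

Lemma phi_sqr_le (s del : R) x a b : 0 < s ->
  (forall j, `|tnth b j - tnth a j| <= del) ->
  phi s (tsub x a) ^+ 2 <=
  expR (D%:R * (del / s) ^+ 2) * phi s (tsub x (reflection a b)) * phi s (tsub x b).
Proof.
move=> s0 ab; rewrite (phi_sqrE x a b s0) -!mulrA.
rewrite ler_wpM2r ?mulr_ge0 ?(ltW (phi_gt0 _ s0))// ler_expR expr_div_n.
by rewrite mulrA ler_pM2r ?invr_gt0 ?exprn_gt0// sqnorm_tsub_le.
Qed.

End fixed_dimension.

End gaussian_comparison.

Section affine_minorants.
Context {R : realType}.

Lemma sqr_le_of_affine_bounds (a b c : R) : 0 < a -> 0 < b ->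
  (forall lam, 0 < lam -> 2 * lam * a <= c + lam ^+ 2 * b) -> a ^+ 2 <= c * b.
Proof.
move=> a0 b0 /(_ (a / b)); rewrite divr_gt0// => /(_ isT).
rewrite (_ : 2 * _ * a = 2 * (a ^+ 2 / b)); last by field; rewrite gt_eqF.
rewrite (_ : _ ^+ 2 * b = a ^+ 2 / b); last by field; rewrite gt_eqF.
by move=> bound; rewrite -ler_pdivrMr//; lra.
Qed.

Lemma affine_bound_of_sqr_le (a b c lam : R) : 0 < b -> a ^+ 2 <= c * b ->
  2 * lam * a <= c + lam ^+ 2 * b.
Proof.
move=> b0 a2_le; rewrite -(ler_pM2r b0) -subr_ge0.
rewrite (_ : _ - _ = (c * b - a ^+ 2) + (a - lam * b) ^+ 2); last by ring.
by rewrite addr_ge0 ?sqr_ge0// subr_ge0.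
Qed.

End affine_minorants.

Section gaussian_mixture.
Context {R : realType} d (T : measurableType d) (Q : probability T R) (D : nat).
Implicit Types (f g c : T -> D.-tuple R) (s : R).

Lemma probability_integral_gt0 (g : T -> \bar R) :
  measurable_fun setT g -> (forall t, (0 < g t)%E) -> (0 < \int[Q]_t g t)%E.
Proof.
move=> mg g0; rewrite lt_neqAle integral_ge0 ?andbT => [|t _]; last exact: ltW.
apply/negP => /eqP intg0.
have [+ _] := ae_eq_integral_abs Q measurableT mg.
under eq_integral do rewrite gee0_abs ?(ltW (g0 _))//.
move=> /(_ (esym intg0))[N [mN N0 gN]].
have NT : N = setT.
  by apply/seteqP; split => // t _; apply: gN => /= /(_ I) gt0; have := g0 t; rewrite gt0 ltxx.
by have := probability_setT Q; rewrite -NT [LHS]N0 => /esym/eqP; rewrite onee_eq0.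
Qed.

Definition gaussian_mixture s f (x : D.-tuple R) : R :=
  fine (\int[Q]_t (phi s (tsub x (f t)))%:E)%E.

Section fixed_scale.
Variables (s : R) (f : T -> D.-tuple R).
Hypotheses (s0 : 0 < s) (mf : measurable_fun setT f).

Let phi_ge0 x m : (0 <= (phi s (tsub x m : D.-tuple R))%:E)%E.
Proof. by rewrite lee_fin ltW// phi_gt0. Qed.

Lemma measurable_phi_tsub_comp x : measurable_fun setT (fun t => (phi s (tsub x (f t)))%:E).
Proof. by apply: measurable_phi_tsub => //; exact: measurable_cst. Qed.

Lemma gaussian_mixtureE x :
  ((gaussian_mixture s f x)%:E = \int[Q]_t (phi s (tsub x (f t)))%:E)%E.
Proof.
rewrite /gaussian_mixture fineK// ge0_fin_numE; last by apply: integral_ge0.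
pose peak := (Num.sqrt (2 * pi * s ^+ 2))^-1 ^+ D : R.
apply: (@le_lt_trans _ _ (\int[Q]_t peak%:E)%E).
  apply: ge0_le_integral => //; first exact: measurable_phi_tsub_comp.
  by move=> t _; rewrite lee_fin phi_le.
by rewrite integral_cst// [X in (_ * X)%E]probability_setT mule1 ltry.
Qed.

Lemma gaussian_mixture_gt0 x : 0 < gaussian_mixture s f x.
Proof.
rewrite -lte_fin gaussian_mixtureE; apply: probability_integral_gt0.
  exact: measurable_phi_tsub_comp.
by move=> t; rewrite lte_fin phi_gt0.
Qed.

Let kernel (u : D.-tuple R * T) : \bar R := (phi s (tsub u.1 (f u.2)))%:E.

Let measurable_kernel : measurable_fun setT kernel.
Proof.
apply: measurable_phi_tsub; first exact: measurable_fst.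
exact: (measurableT_comp mf measurable_snd).
Qed.

Let kernel_ge0 u : (0 <= kernel u)%E. Proof. exact: phi_ge0. Qed.

Lemma measurable_gaussian_mixture : measurable_fun setT (gaussian_mixture s f).
Proof.
apply/measurable_EFinP; rewrite (_ : EFin \o _ = fun x => \int[Q]_t kernel (x, t))%E.
  by apply: measurable_fun_fubini_tonelli_F; [exact: measurable_kernel|exact: kernel_ge0].
by apply/funext => x /=; rewrite gaussian_mixtureE.
Qed.

Lemma positive_density_gaussian_mixture :
  positive_density (tuple_lebesgue D) (gaussian_mixture s f).
Proof.
split=> [|x]; last exact: gaussian_mixture_gt0.
split=> [|x|]; [exact: measurable_gaussian_mixture|exact/ltW/gaussian_mixture_gt0|].
under eq_integral do rewrite gaussian_mixtureE.
rewrite (@fubini_tonelli _ _ _ _ _ (tuple_lebesgue D) Q kernel)//.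
transitivity (\int[Q]_t (cst 1 t))%E.
  by apply: eq_integral => t _; exact: (integral_phi_tsub (f t) s0).
by rewrite integral_cst// mul1e [LHS]probability_setT.
Qed.

End fixed_scale.

Lemma gaussian_mixture_le_affine (a b c s1 s2 s3 : R) f1 f2 f3 x :
  0 <= a -> 0 <= b -> 0 <= c -> 0 < s1 -> 0 < s2 -> 0 < s3 ->
  measurable_fun setT f1 -> measurable_fun setT f2 -> measurable_fun setT f3 ->
  (forall t, a * phi s1 (tsub x (f1 t)) <=
     b * phi s2 (tsub x (f2 t)) + c * phi s3 (tsub x (f3 t))) ->
  a * gaussian_mixture s1 f1 x <=
    b * gaussian_mixture s2 f2 x + c * gaussian_mixture s3 f3 x.
Proof.
move=> a0 b0 c0 s10 s20 s30 mf1 mf2 mf3 le_phi.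
have phi_ge0 e s f t : 0 <= e -> 0 < s -> (0 <= e%:E * (phi s (tsub x (f t)))%:E)%E.
  by move=> e0 s0; rewrite -EFinM lee_fin mulr_ge0// ltW// phi_gt0.
have mphi (e s : R) f : measurable_fun setT f ->
    measurable_fun setT (fun t => e%:E * (phi s (tsub x (f t)))%:E)%E.
  by move=> mf; apply: measurable_funeM; exact: measurable_phi_tsub_comp.
rewrite -lee_fin EFinD (EFinM a) (EFinM b) (EFinM c).
rewrite (gaussian_mixtureE s10 mf1) (gaussian_mixtureE s20 mf2) (gaussian_mixtureE s30 mf3).
rewrite -!ge0_integralZl_EFin//; try exact: measurable_phi_tsub_comp;
  try by move=> t _; rewrite lee_fin ltW// phi_gt0.
rewrite -ge0_integralD//; try exact: mphi; try by move=> t _; exact: phi_ge0.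
apply: ge0_le_integral => //; try exact: mphi.
- by move=> t _; exact: phi_ge0.
- by apply: emeasurable_funD; exact: mphi.
- by move=> t _; rewrite -!EFinM -EFinD lee_fin.
Qed.

Lemma gaussian_mixture_le_scale (s s' rho : R) f c x : 0 < s -> 0 < rho ->
  (1 + rho) * s <= s' <= (1 + rho) ^+ 2 * s ->
  measurable_fun setT f -> measurable_fun setT c ->
  (forall t j, `|tnth (f t) j - tnth (c t) j| <= rho * s) ->
  gaussian_mixture s f x <= expR (3 * rho * D%:R) * gaussian_mixture s' c x.
Proof.
move=> s0 rho0 s'_itv mf mc fc; have /andP[s'_ge _] := s'_itv.
have s'0 : 0 < s' by apply: lt_le_trans s'_ge; rewrite mulr_gt0// addr_gt0.
have := @gaussian_mixture_le_affine 1 (expR (3 * rho * D%:R)) 0 s s' s' f c c x.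
rewrite mul1r mul0r addr0; apply; rewrite ?expR_ge0//.
by move=> t; rewrite mul1r mul0r addr0; apply: phi_le_scale => // j; exact: fc.
Qed.

Definition reflected f g : T -> D.-tuple R := fun t => reflection (f t) (g t).

Lemma measurable_reflected f g : measurable_fun setT f -> measurable_fun setT g ->
  measurable_fun setT (reflected f g).
Proof.
move=> /measurable_fun_tnthP mf /measurable_fun_tnthP mg; apply/measurable_fun_tnthP => j.
rewrite (_ : _ \o _ = fun t => 2 * tnth (f t) j - tnth (g t) j); last first.
  by apply/funext => t; rewrite /= tnth_mktuple.
apply: measurable_funB; last exact: mg.
by apply: measurable_funM; [exact: measurable_cst|exact: mf].
Qed.

(* Cauchy-Schwarz, through the affine minorants [2 lambda p - lambda^2 q] of [p^2 / q]. *)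
Lemma gaussian_mixture_sqr_le (s del : R) f g x : 0 < s ->
  measurable_fun setT f -> measurable_fun setT g ->
  (forall t j, `|tnth (g t) j - tnth (f t) j| <= del) ->
  gaussian_mixture s f x ^+ 2 <= expR (D%:R * (del / s) ^+ 2) *
    gaussian_mixture s (reflected f g) x * gaussian_mixture s g x.
Proof.
move=> s0 mf mg fg; have mr := measurable_reflected mf mg.
apply: sqr_le_of_affine_bounds; try exact: gaussian_mixture_gt0.
move=> lam lam0; apply: gaussian_mixture_le_affine => //.
- by rewrite mulr_ge0// ltW.
- exact: sqr_ge0.
move=> t; apply: affine_bound_of_sqr_le; first exact: phi_gt0.
by apply: phi_sqr_le => // j; exact: fg.
Qed.

Lemma mean_likelihood_ratio_gaussian_mixture_le (s del : R) f g : 0 < s ->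
  measurable_fun setT f -> measurable_fun setT g ->
  (forall t j, `|tnth (g t) j - tnth (f t) j| <= del) ->
  (mean_likelihood_ratio (tuple_lebesgue D) (gaussian_mixture s f) (gaussian_mixture s g)
    <= (expR (D%:R * (del / s) ^+ 2))%:E)%E.
Proof.
move=> s0 mf mg fg.
apply: (@mean_likelihood_ratio_le _ _ _ _ _ _ (gaussian_mixture s (reflected f g))).
- exact: expR_ge0.
- exact: measurable_gaussian_mixture.
- exact: positive_density_gaussian_mixture.
- exact: (positive_density_gaussian_mixture s0 (measurable_reflected mf mg)).1.
- by move=> x; exact: gaussian_mixture_sqr_le.
Qed.

End gaussian_mixture.

Section tuple_densities.
Context {R : realType}.

Lemma open_tuple_set_measurable k (Z : set (k.-tuple R)) :
  open_tuple_set Z -> measurable Z.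
Proof.
move=> oZ.
pose box (u : k.-tuple rat * k.-tuple rat) : set (k.-tuple R) :=
  \bigcap_(j in [set: 'I_k])
    (@tnth k R ^~ j) @^-1` `]ratr (tnth u.1 j), ratr (tnth u.2 j)[%classic.
have mbox u : measurable (box u).
  apply: fin_bigcap_measurable => [|j _]; first exact: finite_finset.
  by rewrite -[X in measurable X]setTI; apply: measurable_tnth.
suff -> : Z = \bigcup_(u in [set u | box u `<=` Z]) box u.
  by rewrite bigcup_mkcond; apply: countable_bigcupT_measurable => [|u];
    [exact: countableP|case: ifPn].
apply/seteqP; split => [z Zz|z [u uZ]]; last exact: uZ.
have [r [r0 rZ]] := oZ _ Zz.
have rat_between j : exists q : rat * rat,
    tnth z j - r < ratr q.1 < tnth z j /\ tnth z j < ratr q.2 < tnth z j + r.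
  have /rat_in_itvoo[a] : tnth z j - r < tnth z j by rewrite ltrBlDr ltrDl.
  have /rat_in_itvoo[b] : tnth z j < tnth z j + r by rewrite ltrDl.
  by rewrite !in_itv /= => ? ?; exists (a, b).
have [q q_itv] := choice rat_between.
exists ([tuple (q j).1 | j < k], [tuple (q j).2 | j < k]) => [w wq|j _] /=.
- apply: rZ => j; have := wq j I; rewrite /= in_itv /= !tnth_mktuple => /andP[w1 w2].
  have [/andP[a1 _] /andP[_ b2]] := q_itv j.
  by rewrite ltr_distl (lt_trans a1 w1) (lt_trans w2 b2).
- rewrite in_itv /= !tnth_mktuple.
  by have [/andP[_ ->] /andP[-> _]] := q_itv j.
Qed.

Lemma hellingerE D (p q : D.-tuple R -> R) :
  measurable_fun setT p -> measurable_fun setT q ->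
  hellinger p q = Num.sqrt (fine (hellinger_sqr (tuple_lebesgue D) p q)).
Proof.
move=> mp mq; rewrite /hellinger lebintE//; first exact: measurable_hellinger_sqr.
by move=> x; rewrite lee_fin sqr_ge0.
Qed.

Lemma lt_hellinger D (p q : D.-tuple R -> R) (eps : R) :
  measurable_fun setT p -> measurable_fun setT q -> 0 <= eps ->
  eps < hellinger p q -> eps ^+ 2 < fine (hellinger_sqr (tuple_lebesgue D) p q).
Proof.
move=> mp mq eps0; rewrite hellingerE// => eps_lt.
rewrite -[ltRHS]sqr_sqrtr ?fine_ge0 ?hellinger_sqr_ge0//.
by rewrite ltr_pXn2r ?nnegrE ?sqrtr_ge0.
Qed.

Lemma has_law_density_lebint D dO (Omega : measurableType dO) (P : probability Omega R)
    (Y : Omega -> D.-tuple R) (p : D.-tuple R -> R) :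
  measurable_fun setT p -> (forall x, 0 <= p x) ->
  (forall B, measurable B -> P (Y @^-1` B) = lebint (fun x => (\1_B x * p x)%:E)) ->
  has_law_density (tuple_lebesgue D) P Y p.
Proof.
move=> mp p0 lawY B mB; rewrite lawY// lebintE.
- rewrite [RHS]integral_mkcond epatch_indic; apply: eq_integral => x _.
  by rewrite /= mulrC.
- by apply/measurable_EFinP; apply: measurable_funM => //; exact: measurable_indic.
- by move=> x; rewrite lee_fin mulr_ge0.
Qed.

Lemma pdensE d D (Z : set (d.-tuple R)) (PZ : probability (d.-tuple R) R)
    (f : d.-tuple R -> D.-tuple R) (s : R) :
  measurable Z -> PZ Z = 1%E -> 0 < s -> measurable_fun Z f ->
  pdens Z PZ f s = gaussian_mixture PZ s (f \_ Z).
Proof.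
move=> mZ PZ1 s0 mf; have mfZ := (measurable_restrictT f mZ).1 mf.
have PZC : PZ (~` Z) = 0%E.
  by rewrite [LHS](probability_setC PZ mZ) [X in (_ - X)%E]PZ1 subee.
have mC : measurable (~` Z) by exact: measurableC.
suff mixE x : (\int[PZ]_z (phi s (tsub x ((f \_ Z) z)))%:E =
    \int[PZ]_(z in Z) (phi s (tsub x (f z)))%:E)%E.
  by apply/funext => x; rewrite /gaussian_mixture mixE.
apply: etrans (ge0_negligible_integral mC measurableT _ _ PZC) _.
- exact: measurable_phi_tsub_comp.
- by move=> z _; rewrite lee_fin ltW// phi_gt0.
- by rewrite setTD setCK; apply: eq_integral => z Zz; rewrite patchT.
Qed.

End tuple_densities.

Section covering.
Context {R : realType} {d D : nat} (Z : set (d.-tuple R)).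
Implicit Types f g : d.-tuple R -> D.-tuple R.

Definition uniformly_close (del : R) f g :=
  forall z j, Z z -> `|tnth (f z) j - tnth (g z) j| <= del.

Lemma supdist_le f g (del : R) :
  (supdist Z f g <= del%:E)%E -> uniformly_close del f g.
Proof.
move=> fg z j Zz; rewrite -lee_fin; apply: le_trans fg.
by apply: ereal_sup_ubound; exists z => //; exists j.
Qed.

Lemma uniformly_close_ge0 (PZ : probability (d.-tuple R) R) f g (del : R) :
  PZ Z = 1%E -> (0 < D)%N -> uniformly_close del f g -> 0 <= del.
Proof.
move=> PZ1 D0 fg; have [Z0|/set0P[z Zz]] := eqVneq Z set0.
  by move: PZ1; rewrite Z0 measure0 => -[] /eqP; rewrite eq_sym oner_eq0.
exact: le_trans (fg z (Ordinal D0) Zz).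
Qed.

Lemma uniformly_close_patch f g (del : R) : 0 <= del -> uniformly_close del f g ->
  forall z j, `|tnth ((f \_ Z) z) j - tnth ((g \_ Z) z) j| <= del.
Proof.
move=> del0 fg z j; rewrite !patchE; case: ifPn => [/set_mem Zz|_]; first exact: fg.
by rewrite subrr normr0.
Qed.

Definition covering_entropy_le (F : set (d.-tuple R -> D.-tuple R)) (s A : R) :=
  forall del : R, 0 < del ->
  (covering_number Z F del <= (expR (s * (A + Num.max 1 (ln del^-1))))%:E)%E.

(* The centers of a cover need not lie in [F]; moving them into [F] doubles the radius. *)
Lemma covering_centers (F : set (d.-tuple R -> D.-tuple R)) (del B : R) :
  F !=set0 -> (covering_number Z F del <= B%:E)%E ->
  exists N (c : 'I_N -> d.-tuple R -> D.-tuple R),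
  [/\ N%:R <= B + 1, forall i, F (c i) &
      forall f, F f -> exists i, uniformly_close (2 * del) f (c i)].
Proof.
move=> [f0 Ff0] covB.
have /ereal_inf_lt[_ [N [c cov] <-] NB] : (covering_number Z F del < (B + 1)%:E)%E.
  by apply: (le_lt_trans covB); rewrite lte_fin ltrDl.
have /choice[c' c'_spec] : forall i, exists f, F f /\
    ((exists2 g, F g & (supdist Z g (c i) <= del%:E)%E) ->
     (supdist Z f (c i) <= del%:E)%E).
  move=> i; have [[g Fg gi]|no_g] :=
    pselect (exists2 g, F g & (supdist Z g (c i) <= del%:E)%E).
    by exists g.
  by exists f0.
exists N, c'; split; [by rewrite -lee_fin ltW|by move=> i; case: (c'_spec i)|].
move=> f Ff; have [i fi] := cov f Ff; exists i => z j Zz.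
have [_ /(_ (ex_intro2 _ _ f Ff fi)) c'i] := c'_spec i.
rewrite (le_trans (ler_distD (tnth (c i z) j) _ _))// mulr2n mulrDl mul1r lerD//.
  exact: (supdist_le fi).
by rewrite distrC; exact: (supdist_le c'i).
Qed.

End covering.

Section scale_grid.
Context {R : realType}.

Definition scale_grid (rho smin : R) (k : nat) : R :=
  (1 + rho) ^+ 2 * (smin * (1 + rho * k%:R)).

Lemma scale_grid_gt0 (rho smin : R) k : 0 < rho -> 0 < smin -> 0 < scale_grid rho smin k.
Proof.
move=> rho0 smin0; have k0 : 0 <= rho * k%:R by rewrite mulr_ge0// ltW.
by rewrite /scale_grid mulr_gt0 ?exprn_gt0 ?mulr_gt0//; lra.
Qed.

Lemma scale_grid_cover (rho smin smax s : R) : 0 < rho -> 0 < smin -> smin <= s <= smax ->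
  exists k : 'I_(Num.truncn (smax / (smin * rho))).+1,
  (1 + rho) * s <= scale_grid rho smin k <= (1 + rho) ^+ 2 * s.
Proof.
move=> rho0 smin0 /andP[s_ge s_le].
have step0 : 0 < smin * rho by rewrite mulr_gt0.
pose y := (s - smin) / (smin * rho).
have y0 : 0 <= y by rewrite divr_ge0 ?subr_ge0// ltW.
have sE : s = smin + y * (smin * rho) by rewrite /y divfK ?gt_eqF// addrC subrK.
have /andP[ky yk] := truncn_itv y0.
have kG : (Num.truncn y < (Num.truncn (smax / (smin * rho))).+1)%N.
  by rewrite ltnS le_truncn// ler_pM2r ?invr_gt0// lerBlDr (le_trans s_le)// lerDl ltW.
exists (Ordinal kG); rewrite /scale_grid /=.
move: ky yk; rewrite -natr1; set k := (Num.truncn y)%:R => ky yk.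
have k0 : 0 <= k by rewrite /k.
have kstep : k * (smin * rho) <= y * (smin * rho) by rewrite ler_pM2r.
have ystep : y * (smin * rho) <= (k + 1) * (smin * rho) by rewrite ler_pM2r// ltW.
have kstep0 : 0 <= k * (smin * rho) * rho by rewrite !mulr_ge0// ltW.
have r10 : 0 < 1 + rho by rewrite addr_gt0.
rewrite [X in _ && X]ler_pM2l ?exprn_gt0// expr2 -mulrA ler_pM2l//.
by apply/andP; split; rewrite sE; lra.
Qed.

End scale_grid.

Section bracketing_entropy.
Context {R : realType}.

Definition entropy_bound (s A smin : R) (n : nat) : R := s * (A + ln (n%:R / smin)).

Lemma ln_ratio_ge0 (smin : R) n : (0 < n)%N -> 0 < smin <= 1 -> 0 <= ln (n%:R / smin).
Proof.
move=> n0 /andP[smin0 smin1]; apply: ln_ge0.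
by rewrite ler_pdivlMr// mul1r (le_trans smin1)// ler1n.
Qed.

Lemma entropy_bound_ge1 (s A smin : R) n : (0 < n)%N -> 0 < smin <= 1 ->
  1 <= s -> 1 <= A -> 1 <= entropy_bound s A smin n.
Proof.
move=> n0 smin_itv s1 A1; have L0 := ln_ratio_ge0 n0 smin_itv.
by rewrite /entropy_bound; nra.
Qed.

Lemma covering_bound_le (s A smin : R) n : (0 < n)%N -> 0 < smin <= 1 ->
  1 <= s -> 1 <= A ->
  expR (s * (A + Num.max 1 (ln (smin / n%:R / 2)^-1))) + 1 <=
  expR (3 * entropy_bound s A smin n).
Proof.
move=> n0 smin_itv s1 A1; have L0 := ln_ratio_ge0 n0 smin_itv.
have nR : 0 < n%:R :> R by rewrite ltr0n.
have /andP[smin0 _] := smin_itv.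
rewrite /entropy_bound; set L := ln _ in L0 *.
have ln2_le : ln 2 <= 1 :> R by rewrite -[2]/(1 + 1) le_ln1Dx.
have maxL : Num.max 1 (ln (smin / n%:R / 2)^-1) <= 1 + L.
  rewrite ge_max lerDl L0/= (_ : _^-1 = 2 * (n%:R / smin)); last by field; rewrite !gt_eqF.
  by rewrite lnM ?posrE ?divr_gt0// lerD2r.
have e_le : expR (s * (A + Num.max 1 (ln (smin / n%:R / 2)^-1))) <= expR (s * (A + (1 + L))).
  by rewrite ler_expR ler_wpM2l ?lerD2l//; lra.
have e1 : 1 <= expR (s * (A + (1 + L))) by rewrite -[leLHS]expR0 ler_expR; nra.
have two_le : 2 <= expR 1 :> R by have := expR_ge1Dx (1 : R); lra.
apply: (@le_trans _ _ (expR 1 * expR (s * (A + (1 + L))))); first by nra.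
by rewrite -expRD ler_expR; nra.
Qed.

Lemma grid_size_le (s A smin smax : R) n : (0 < n)%N -> 0 < smin <= 1 -> 0 < smax ->
  1 <= s -> 1 <= A ->
  (Num.truncn (smax / (smin * n%:R^-1))).+1%:R <= expR ((1 + smax) * entropy_bound s A smin n).
Proof.
move=> n0 smin_itv smax0 s1 A1; have L0 := ln_ratio_ge0 n0 smin_itv.
have B1 := entropy_bound_ge1 n0 smin_itv s1 A1.
have nR : 0 < n%:R :> R by rewrite ltr0n.
have /andP[smin0 smin1] := smin_itv.
have ratio0 : 0 < n%:R / smin by exact: divr_gt0.
have ratio1 : 1 <= n%:R / smin by rewrite -ler_ln ?posrE// ln1.
have -> : smax / (smin * n%:R^-1) = smax * (n%:R / smin) by field; rewrite !gt_eqF.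
have /andP[size_le _] := truncn_itv (mulr_ge0 (ltW smax0) (ltW ratio0)).
rewrite -natr1 (le_trans (lerD size_le (lexx 1)))//.
apply: (@le_trans _ _ ((1 + smax) * (n%:R / smin))); first by nra.
apply: (@le_trans _ _ (expR smax * expR (ln (n%:R / smin)))).
  by rewrite lnK ?posrE// ler_pM2r// expR_ge1Dx.
rewrite -expRD ler_expR; move: B1; rewrite /entropy_bound; nra.
Qed.

End bracketing_entropy.

Section rate.
Context {R : realType}.

Lemma scaled_max_sqr_ge (C a b : R) : 1 <= C -> 0 <= a -> 0 <= b ->
  C * a ^+ 2 <= (C * Num.max a b) ^+ 2 /\ C * b ^+ 2 <= (C * Num.max a b) ^+ 2.
Proof.
move=> C1 a0 b0.
have sqr_le x : 0 <= x -> x <= Num.max a b -> C * x ^+ 2 <= (C * Num.max a b) ^+ 2.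
  move=> x0 x_le; have C0 : 0 <= C by lra.
  apply: (@le_trans _ _ ((C * x) ^+ 2)).
    by rewrite exprMn ler_wpM2r ?sqr_ge0// expr2 ler_peMl.
  have [Cx0 Cx_le] : 0 <= C * x /\ C * x <= C * Num.max a b.
    by rewrite mulr_ge0// ler_wpM2l.
  by rewrite lerXn2r ?nnegrE// (le_trans Cx0).
by split; apply: sqr_le => //; rewrite le_max lexx ?orbT.
Qed.

Lemma deviation_bound_le (D smax B m e v : R) : 0 <= D -> 0 < smax -> 1 <= B -> 0 < m ->
  (16 * (4 + smax) + 48 * D) * (B / m) <= e -> (16 * (4 + smax) + 48 * D) * v <= e ->
  0 <= v ->
  expR ((4 + smax) * B + 3 * D - m * e / 12) + expR (m * (D * v - e / 6))
    <= 5 * expR (- 48^-1 * m * e).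
Proof.
move=> D0 smax0 B1 m0 Be ve v0.
have me_ge : (16 * (4 + smax) + 48 * D) * B <= m * e.
  by rewrite [leRHS]mulrC -ler_pdivrMr// -mulrA.
have DB : D <= D * B by rewrite ler_peMr.
have smaxB : 0 <= (4 + smax) * B by rewrite mulr_ge0; lra.
have smaxv : 0 <= smax * v by rewrite mulr_ge0// ltW.
have bracket_le : expR ((4 + smax) * B + 3 * D - m * e / 12) <= expR (- 48^-1 * m * e).
  by rewrite ler_expR -mulrA; lra.
have approx_le : expR (m * (D * v - e / 6)) <= expR (- 48^-1 * m * e).
  rewrite ler_expR -mulrA [leRHS]mulrCA ler_pM2l//; nra.
by have := expR_ge0 (- 48^-1 * m * e); lra.
Qed.

End rate.

Section mixture_mle.
Context {R : realType} (d D n : nat) (Z : set (d.-tuple R)) (PZ : probability (d.-tuple R) R).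
Variables (smin smax : R) (F : set (d.-tuple R -> D.-tuple R)).
Hypotheses (n_gt0 : (0 < n)%N) (mZ : measurable Z) (PZ1 : PZ Z = 1%E).
Hypotheses (smin_itv : 0 < smin <= 1) (smax_gt0 : 0 < smax).
Hypothesis mF : forall f, F f -> measurable_fun Z f.

Let smin_gt0 : 0 < smin. Proof. by case/andP: smin_itv. Qed.

Let measurable_patch (f : d.-tuple R -> D.-tuple R) :
  measurable_fun Z f -> measurable_fun setT (f \_ Z).
Proof. by move=> mf; apply/(measurable_restrictT _ mZ). Qed.

Lemma positive_density_pdens f s : measurable_fun Z f -> 0 < s ->
  positive_density (tuple_lebesgue D) (pdens Z PZ f s).
Proof.
move=> mf s0; rewrite pdensE//; apply: positive_density_gaussian_mixture => //.
exact: measurable_patch.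
Qed.

Lemma pdens_bracketing (s A : R) :
  F !=set0 -> 1 <= s -> 1 <= A -> covering_entropy_le Z F s A ->
  exists (I : finType) (q : I -> D.-tuple R -> R),
  [/\ #|I|%:R <= expR ((4 + smax) * entropy_bound s A smin n),
      forall i, positive_density (tuple_lebesgue D) (q i) &
      forall f t, F f -> smin <= t <= smax -> exists i, forall x,
        pdens Z PZ f t x <= expR (3 * D%:R / n%:R) * q i x].
Proof.
move=> F0 s1 A1 covF.
have nR : 0 < n%:R :> R by rewrite ltr0n.
have rho0 : 0 < n%:R^-1 :> R by rewrite invr_gt0.
have [|N [c [N_le Fc c_cov]]] := covering_centers F0 (covF (smin / n%:R / 2) _).
  by rewrite !divr_gt0.
pose G := (Num.truncn (smax / (smin * n%:R^-1))).+1.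
exists ('I_N * 'I_G)%type.
exists (fun i : 'I_N * 'I_G => pdens Z PZ (c i.1) (scale_grid n%:R^-1 smin i.2)); split.
- rewrite card_prod !card_ord natrM (_ : 4 + smax = 3 + (1 + smax)); last by ring.
  rewrite mulrDl expRD ler_pM//; last exact: grid_size_le.
  exact: le_trans N_le (covering_bound_le n_gt0 smin_itv s1 A1).
- by move=> i; apply: positive_density_pdens; [exact: mF|exact: scale_grid_gt0].
- move=> f t Ff t_itv; have /andP[t_ge _] := t_itv.
  have t0 : 0 < t by exact: lt_le_trans t_ge.
  have [i] := c_cov f Ff; rewrite mulrC divfK// => fc.
  have [k k_itv] := scale_grid_cover rho0 smin_gt0 t_itv.
  exists (i, k) => x; rewrite !pdensE//; [|exact: scale_grid_gt0|exact: mF|exact: mF].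
  rewrite (_ : 3 * D%:R / n%:R = 3 * n%:R^-1 * D%:R); last by ring.
  apply: gaussian_mixture_le_scale => //.
  + exact: measurable_patch (mF Ff).
  + exact: measurable_patch (mF (Fc i)).
  move=> z j; apply: (@le_trans _ _ (smin / n%:R)); last by rewrite mulrC ler_pM2l.
  by apply: uniformly_close_patch fc z j; rewrite divr_ge0// ltW.
Qed.

Lemma mean_likelihood_ratio_pdens_le (f g : d.-tuple R -> D.-tuple R) (s del : R) :
  0 < s -> 0 <= del -> measurable_fun Z f -> measurable_fun Z g ->
  uniformly_close Z del g f ->
  (mean_likelihood_ratio (tuple_lebesgue D) (pdens Z PZ f s) (pdens Z PZ g s)
    <= (expR (D%:R * (del / s) ^+ 2))%:E)%E.
Proof.
move=> s0 del0 mf mg gf; rewrite !pdensE//.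
apply: mean_likelihood_ratio_gaussian_mixture_le => //; try exact: measurable_patch.
exact: uniformly_close_patch.
Qed.

Context dO (Omega : measurableType dO) (P : probability Omega R).
Variables (X : 'I_n -> Omega -> D.-tuple R) (fstar f0 : d.-tuple R -> D.-tuple R).
Variables (sstar dapp : R).
Let pstar := pdens Z PZ fstar sstar.
Hypotheses (mfstar : measurable_fun Z fstar) (sstar_itv : smin <= sstar <= smax).
Hypotheses (dapp_ge0 : 0 <= dapp) (Ff0 : F f0) (f0_close : uniformly_close Z dapp f0 fstar).
Hypothesis mX : forall i, measurable_fun setT (X i).
Hypothesis indep : mutually_independent P X.
Hypothesis lawX : forall i B, measurable B ->
  P (X i @^-1` B) = lebint (fun x => (\1_B x * pstar x)%:E).
Variables (fhat : Omega -> d.-tuple R -> D.-tuple R) (shat : Omega -> R) (eta : R).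
Let phat w := pdens Z PZ (fhat w) (shat w).
Hypothesis hat_model : forall w, F (fhat w) /\ smin <= shat w <= smax.
Hypothesis mle : forall w f s, F f -> smin <= s <= smax ->
  log_likelihood X (pdens Z PZ f s) w - eta <= log_likelihood X (phat w) w.

Theorem mixture_mle_deviation (s A eps : R) :
  1 <= s -> 1 <= A -> covering_entropy_le Z F s A ->
  0 <= eps -> eta <= n%:R * (eps ^+ 2 / 6) ->
  exists E : set Omega, [/\ measurable E, [set w | eps < hellinger (phat w) pstar] `<=` E &
    (P E <= (expR ((4 + smax) * entropy_bound s A smin n + 3 * D%:R - n%:R * eps ^+ 2 / 12) +
             expR (n%:R * (D%:R * (dapp / sstar) ^+ 2 - eps ^+ 2 / 6)))%:E)%E].
Proof.
move=> s1 A1 covF eps0 eta_le.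
have [sstar0 nR] : 0 < sstar /\ 0 < n%:R :> R.
  by rewrite ltr0n; case/andP: sstar_itv => /(lt_le_trans smin_gt0).
have dstar : positive_density (tuple_lebesgue D) pstar by exact: positive_density_pdens.
have dhat w : positive_density (tuple_lebesgue D) (phat w).
  have [Fw /andP[s_ge _]] := hat_model w.
  by apply: positive_density_pdens; [exact: mF|exact: lt_le_trans s_ge].
have [[mpstar pstar_ge0 _] _] := dstar.
have law i : has_law_density (tuple_lebesgue D) P (X i) pstar.
  exact: has_law_density_lebint (lawX i).
have [I [q [card_I dq q_dom]]] := pdens_bracketing (ex_intro _ f0 Ff0) s1 A1 covF.
have ratio_le := mean_likelihood_ratio_pdens_le sstar0 dapp_ge0 mfstar (mF Ff0) f0_close.
have [E [mE far_E PE]] := approximate_mle_deviation mX indep law dstar dq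
  (positive_density_pdens (mF Ff0) sstar0) dhat ratio_le
  (fun w => q_dom _ _ (hat_model w).1 (hat_model w).2) (fun w => mle w Ff0 sstar_itv) eta_le.
exists E; split=> //.
  move=> w far_w; apply: far_E; have [[mphat _ _] _] := dhat w.
  exact: lt_hellinger mphat mpstar eps0 far_w.
rewrite (le_trans PE)// lee_fin lerD2r.
apply: (le_trans (ler_wpM2r (expR_ge0 _) card_I)); rewrite -expRD ler_expR.
rewrite le_eqVlt; apply/orP; left; apply/eqP; field.
by rewrite gt_eqF.
Qed.

Definition rate_constant : R := 16 * (4 + smax) + 48 * D%:R.

Lemma rate_constant_ge1 : 1 <= rate_constant.
Proof. by move: smax_gt0 (ler0n R D); rewrite /rate_constant; lra. Qed.

Theorem mixture_mle_rate (s A : R) : 1 <= s -> 1 <= A -> covering_entropy_le Z F s A ->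
  let eps := rate_constant *
    Num.max (Num.sqrt (entropy_bound s A smin n / n%:R)) (dapp / sstar) in
  eta <= eps ^+ 2 / 6 ->
  exists E : set Omega, [/\ measurable E, [set w | eps < hellinger (phat w) pstar] `<=` E &
    (P E <= (5 * expR (- 48^-1 * n%:R * eps ^+ 2))%:E)%E].
Proof.
move=> s1 A1 covF; have B1 := entropy_bound_ge1 n_gt0 smin_itv s1 A1.
set B := entropy_bound _ _ _ _ in B1 * => eps eta_le.
have [C_ge1 nR] : 1 <= rate_constant /\ 0 < n%:R :> R by rewrite rate_constant_ge1 ltr0n.
have v0 : 0 <= dapp / sstar.
  by rewrite divr_ge0//; case/andP: sstar_itv => /(lt_le_trans smin_gt0)/ltW.
have [epsB epsv] := scaled_max_sqr_ge C_ge1 (sqrtr_ge0 (B / n%:R)) v0.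
rewrite sqr_sqrtr ?(divr_ge0 (le_trans ler01 B1) (ltW nR))// in epsB.
have eps0 : 0 <= eps by rewrite mulr_ge0 ?le_max ?sqrtr_ge0//; lra.
have eta_le_n : eta <= n%:R * (eps ^+ 2 / 6).
  by rewrite (le_trans eta_le)// ler_peMl ?divr_ge0 ?sqr_ge0// ler1n.
have [E [mE far_E PE]] := mixture_mle_deviation s1 A1 covF eps0 eta_le_n.
exists E; split=> //; rewrite (le_trans PE)// lee_fin.
exact: (deviation_bound_le _ smax_gt0 B1 nR epsB epsv (sqr_ge0 _)).
Qed.

End mixture_mle.

Theorem theorem1 (R : realType) :
  exists C1 : R, 0 < C1 /\
  forall D : nat, (0 < D)%N ->
  exists C2 delta_star : R, 0 < delta_star /\
  forall K sigma_max : R, 0 < K -> 0 < sigma_max ->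
  exists C3 : R, 0 < C3 /\
  forall (n d : nat) (Z : set (d.-tuple R)) (PZ : probability (d.-tuple R) R)
    (sigma_min : R) (F : set (d.-tuple R -> D.-tuple R)) (s A : R)
    (fstar : d.-tuple R -> D.-tuple R) (sigma_star delta_app eta : R)
    (dO : measure_display) (Omega : measurableType dO) (P : probability Omega R)
    (X : 'I_n -> Omega -> D.-tuple R)
    (fhat : Omega -> d.-tuple R -> D.-tuple R) (sigmahat : Omega -> R),
  (0 < n)%N -> (0 < d)%N ->
  open_tuple_set Z ->
  PZ Z = 1%E ->
  0 < sigma_min -> sigma_min < sigma_max -> sigma_min <= 1 ->
  (forall f, F f -> measurable_fun Z f) ->
  (forall f, F f -> (supdist Z f (fun _ => [tuple (0%R : R) | _ < D]) <= K%:E)%E) ->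
  1 <= s -> 1 <= A ->
  (forall delta : R, 0 < delta ->
     (covering_number Z F delta
       <= (expR (s * (A + Num.max 1 (ln (delta^-1)))))%:E)%E) ->
  measurable_fun Z fstar ->
  sigma_min <= sigma_star <= sigma_max ->
  delta_app <= 1 ->
  (exists f, F f /\ (supdist Z f fstar <= delta_app%:E)%E) ->
  (* X_1, ..., X_n are measurable, mutually independent, with density p_* *)
  (forall i, measurable_fun setT (X i)) ->
  (forall B : 'I_n -> set (D.-tuple R), (forall i, measurable (B i)) ->
     P (\bigcap_(i in [set: 'I_n]) (X i @^-1` B i))
       = (\prod_(i < n) P (X i @^-1` B i))%E) ->
  (forall i (B : set (D.-tuple R)), measurable B ->
     P (X i @^-1` B)
       = lebint (fun x => ((\1_B x : R) * pdens Z PZ fstar sigma_star x)%:E)) ->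
  (* (fhat, sigmahat) is an eta-approximate maximum likelihood estimator *)
  (forall w, F (fhat w) /\ sigma_min <= sigmahat w <= sigma_max) ->
  (forall w, forall f sigma, F f -> sigma_min <= sigma <= sigma_max ->
     \sum_(i < n) ln (pdens Z PZ (fhat w) (sigmahat w) (X i w))
       >= \sum_(i < n) ln (pdens Z PZ f sigma (X i w)) - eta) ->
  let eps := C3 * Num.max (Num.sqrt (s * (A + ln (n%:R / sigma_min)) / n%:R))
                          (delta_app / sigma_star) in
  eta <= eps ^+ 2 / 6 ->
  eps <= Num.sqrt 2 * delta_star ->
  (* outer probability of the event {d_H(phat, p_* ) > eps} *)
  exists E : set Omega, measurable E /\
    [set w | hellinger (pdens Z PZ (fhat w) (sigmahat w)) (pdens Z PZ fstar sigma_star) > eps]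
      `<=` E /\
    (P E <= (5 * expR (- C1 * n%:R * eps ^+ 2) + C2 / n%:R)%:E)%E.
Proof.
exists 48^-1; split; first by rewrite invr_gt0.
move=> D D0; exists 0, 1; split=> // K smax _ smax0.
exists (rate_constant D smax); split; first exact: lt_le_trans (rate_constant_ge1 _ _).
move=> n d Z PZ smin F s A fstar sstar dapp eta dO Omega P X fhat shat.
move=> n0 _ oZ PZ1 smin0 _ smin1 mF _ s1 A1 covF mfstar sstar_itv _.
move=> [f0 [Ff0 /supdist_le f0_close]] mX indep lawX hat_model mle eps eta_le _.
have mZ := open_tuple_set_measurable oZ.
have smin_itv : 0 < smin <= 1 by rewrite smin0.
have dapp0 := uniformly_close_ge0 PZ1 D0 f0_close.
have [E [mE far_E PE]] := mixture_mle_rate n0 mZ PZ1 smin_itv smax0 mF mfstar sstar_itv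
  dapp0 Ff0 f0_close mX indep lawX hat_model mle s1 A1 covF eta_le.
by exists E; split=> //; split=> //; rewrite mul0r addr0.
Qed.
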